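(* Let $k,q\ge 1$ be integers, let $E$ be a subset of $\mathbb{R}^k$ endowed with a norm $|\cdot|$, let $(\epsilon_t)_{t\in\mathbb{Z}}$ be an i.i.d. sequence of random variables with values in a measurable space $G$, and let $F:E^q\times G\to E$ be measurable. Consider the recursive equations $$X_t=F(X_{t-1},\dots,X_{t-q},\epsilon_t),\qquad t\in\mathbb{Z}. \qquad (\ast)$$ Assume: (A1) For every $y\in E^q$, $\mathbb{E}\left[|F(y,\epsilon_0)|\right]<\infty$. (A2) There exist $k\times k$ matrices $A_1,\dots,A_q$ with nonnegative entries, satisfying $\rho(A_1+\cdots+A_q)<1$, such that for all $y=(y_1,\dots,y_q),\,y'=(y'_1,\dots,y'_q)\in E^q$, $$\mathbb{E}\left[|F(y,\epsilon_1)-F(y',\epsilon_1)|_{vec}\right]\preceq\sum_{i=1}^qA_i|y_i-y_i'|_{vec}.$$ Then: 1. There exists a unique stationary and non-anticipative process $(X_t)_{t\in\mathbb{Z}}$, solution of $(\ast)$, such that $\mathbb{E}[|X_t|]<\infty$. 2. Suppose in addition that (A3) holds: for an integer $\overline{k}>1$, there exist a vector $\phi=(\phi_1,\dots,\phi_{\overline{k}})$ of continuous functions from $E$ to $\mathbb{R}_+$, a real number $r\ge1$, $\overline{k}\times\overline{k}$ matrices $D_1,\dots,D_q$ with nonnegative entries such that $\rho(D_1+\cdots+D_q)<1$, and $c\in\mathbb{R}_+^{\overline{k}}$ such that for all $y=(y_1,\dots,y_q)\in E^q$, $$\left\|\phi(F(y,\epsilon_1))\right\|_{r,vec}\preceq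 c+\sum_{i=1}^qD_i\phi(y_i).$$ Then $\mathbb{E}\left[|\phi(X_0)|_1^r\right]<\infty$.
   Context: $\rho(\cdot)$ denotes the spectral radius of a square matrix. For $x\in\mathbb{R}^d$, $|x|_{vec}=(|x_1|,\dots,|x_d|)'$ and $|x|_1=\sum_{i=1}^d|x_i|$. For $x,x'\in\mathbb{R}^d$, $x\preceq x'$ means $x_i\le x_i'$ for $i=1,\dots,d$. For a random vector $Z=(Z_1,\dots,Z_{\overline{k}})$, $\|Z\|_{r,vec}=\left(\mathbb{E}^{1/r}[|Z_1|^r],\dots,\mathbb{E}^{1/r}[|Z_{\overline{k}}|^r]\right)'$. A process $(X_t)_{t\in\mathbb{Z}}$ is non-anticipative if $X_t$ is measurable with respect to $\sigma(\epsilon_s:s\le t)$ for every $t$. Expectations of vectors are taken componentwise, and uniqueness is up to almost sure equality.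
   Formalization: The set E is assumed nonempty and closed in R^k; without this existence can fail, e.g. for E=(0,1], k=q=1, F(y,e)=y/2, where (A1) and (A2) hold but there is no E-valued solution. *)

(* Defs.v *)
From HB Require Import structures.
From mathcomp Require Import all_boot all_order all_algebra finmap.
From mathcomp Require Import complex.
From mathcomp Require Import all_classical all_reals all_analysis.

Set Implicit Arguments.
Unset Strict Implicit.
Unset Printing Implicit Defensive.

Import Order.TTheory GRing.Theory Num.Theory.
Import numFieldNormedType.Exports.

Local Open Scope classical_set_scope.
Local Open Scope ring_scope.

(* The maximum modulus of the complex eigenvalues. For [0 < k] the set below is
   finite and nonempty, so that the [sup] is a maximum. *)
Definition spectral_radius (R : realType) (k : nat) (A : 'M[R]_k) : R :=
  sup [set ComplexField.Normc.normc z
      | z in [set z : R[i] | eigenvalue (map_mx (real_complex R) A) z]].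

Definition nonneg_mx (R : realType) (m n : nat) (A : 'M[R]_(m, n)) : Prop :=
  forall i j, 0 <= A i j.

Definition vabs (R : realType) (k : nat) (x : 'cV[R]_k) : 'cV[R]_k :=
  map_mx Num.norm x.

Definition norm1 (R : realType) (k : nat) (x : 'cV[R]_k) : R :=
  \sum_(i < k) `|x i 0|.

Definition is_norm (R : realType) (k : nat) (N : 'cV[R]_k -> R) : Prop :=
  [/\ forall x y, N (x + y) <= N x + N y,
      forall a x, N (a *: x) = `|a| * N x &
      forall x, N x = 0 -> x = 0].

(* R^k with its Borel sigma-algebra. The topology of the library on matrices is
   that of the sup norm, hence that of any norm on R^k. *)
Notation borelV R k := (g_sigma_algebraType (@open 'cV[R]_k)).

(* The subset E^q of (R^k)^q. *)
Definition tuples_in (R : realType) (k q : nat) (E : set (borelV R k)) :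
    set (q.-tuple (borelV R k)) :=
  [set y | forall i, E (tnth y i)].

(* The sigma-algebra generated by the functions [f i] for [i] in [D]. *)
Definition sigma_family (I aT : Type) (d : measure_display)
    (rT : measurableType d) (D : set I) (f : I -> aT -> rT) : set (set aT) :=
  <<s \bigcup_(i in D) preimage_set_system setT (f i) measurable >>.

(* The componentwise order; [u] is a vector of expectations of nonnegative
   functions, which may a priori be infinite. *)
Definition vle (R : realType) (k : nat) (u : 'I_k -> \bar R) (x : 'cV[R]_k) :
    Prop :=
  forall j, (u j <= (x j 0)%:E)%E.

Section probability.
Context (d : measure_display) (T : measurableType d) (R : realType)
  (P : probability T R).

Definition expectation_vec (k : nat) (Z : T -> 'cV[R]_k) (j : 'I_k) : \bar R :=
  ('E_P[fun w => (Z w j 0)%R])%E.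

Definition Lnorm_vec (r : R) (k : nat) (Z : T -> 'cV[R]_k) (j : 'I_k) : \bar R :=
  Lnorm P r%:E (fun w => (Z w j 0)%:E).

Definition mutually_independent (dG : measure_display) (G : measurableType dG)
    (eps : int -> {RV P >-> G}) : Prop :=
  forall (J : {fset int}) (B : int -> set G),
    (forall t, t \in J -> measurable (B t)) ->
    P (\bigcap_(t in [set` J]) (eps t @^-1` B t)) =
    (\prod_(t <- J) P (eps t @^-1` B t))%E.

Definition identically_distributed (dG : measure_display)
    (G : measurableType dG) (eps : int -> {RV P >-> G}) : Prop :=
  forall (s t : int) (B : set G), measurable B ->
    distribution P (eps s) B = distribution P (eps t) B.

Definition iid (dG : measure_display) (G : measurableType dG)
    (eps : int -> {RV P >-> G}) : Prop :=
  mutually_independent eps /\ identically_distributed eps.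

(* Strict stationarity: the shifted processes all have the same law on the space
   of trajectories, equipped with the product sigma-algebra. *)
Definition stationary (k : nat) (X : int -> T -> borelV R k) : Prop :=
  forall (h : int) (B : set (int -> borelV R k)),
    sigma_family setT (fun (t : int) (x : int -> borelV R k) => x t) B ->
    P ((fun w t => X (t + h) w) @^-1` B) = P ((fun w t => X t w) @^-1` B).

Definition non_anticipative (dG : measure_display) (G : measurableType dG)
    (eps : int -> {RV P >-> G}) (k : nat) (X : int -> T -> borelV R k) : Prop :=
  forall (t : int) (B : set (borelV R k)), measurable B ->
    sigma_family [set s : int | s <= t] (fun s => eps s : T -> G)
      (X t @^-1` B).

(* The vector (X_{t-1}, ..., X_{t-q}): the index [i : 'I_q] starts at 0. *)
Definition lags (k q : nat) (X : int -> T -> borelV R k) (t : int) (w : T) :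
    q.-tuple (borelV R k) :=
  [tuple X (t - (i.+1)%:Z) w | i < q].

Definition solves (dG : measure_display) (G : measurableType dG)
    (eps : int -> {RV P >-> G}) (k q : nat)
    (F : q.-tuple (borelV R k) * G -> borelV R k)
    (X : int -> T -> borelV R k) : Prop :=
  forall t : int, {ae P, forall w, X t w = F (lags q X t w, eps t w)}.

Definition integrable_stationary_solution (dG : measure_display)
    (G : measurableType dG) (eps : int -> {RV P >-> G}) (k q : nat)
    (E : set (borelV R k)) (N : 'cV[R]_k -> R)
    (F : q.-tuple (borelV R k) * G -> borelV R k)
    (X : int -> T -> borelV R k) : Prop :=
  [/\ forall t w, E (X t w),
      stationary X,
      non_anticipative eps X,
      solves eps F X &
      forall t, ('E_P[fun w => N (X t w)] < +oo)%E].

End probability.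

(* Main.v *)
(** The contraction (A2), applied conditionally on the past (which is independent
    of the current innovation), shows that if the componentwise mean distances
    between two adapted processes are bounded at all times by a vector b, then
    those between their images under the recursion are bounded by A b, where
    A = A_1 + ... + A_q. Since rho(A) < 1, the iterates A^n b decay geometrically:
    by Cayley-Hamilton, A is annihilated by a product of factors X - z with
    |z| < 1, and these are removed one at a time. Two integrable stationary
    solutions have a bounded mean distance, which is therefore zero. For existence,
    start from a constant process and iterate: the increments are summable in
    mean, so that the iterates converge almost surely to a solution, which is
    stationary because it is a shift-equivariant function of the noise. For the
    moments, Minkowski's inequality gives the bounds m_(n+1) = c + D m_n on the
    L^r norms of phi along the iterates; they stay bounded, and Fatou's lemma
    passes to the limit. *)

Require Import Defs.
From HB Require Import structures.
From mathcomp Require Import all_boot all_order all_algebra finmap.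
From mathcomp Require Import complex.
From mathcomp Require Import all_classical all_reals all_analysis.
From mathcomp Require Import measurable_realfun ring lra.

Import Order.TTheory GRing.Theory Num.Theory.
Import numFieldNormedType.Exports.

Local Open Scope classical_set_scope.
Local Open Scope ring_scope.

Set Implicit Arguments.
Unset Strict Implicit.
Unset Printing Implicit Defensive.

(** * Powers of a matrix of spectral radius less than one *)

(* With [B' = B * (A - z)], the powers satisfy [B * A ^+ m.+1 = z *: (B * A ^+ m) +
   B' * A ^+ m], a scalar recurrence with a geometric source term. *)
Lemma annihilated_expmx_geometric (C : numFieldType) n (A B : 'M[C]_n.+1)
    (s : seq C) (r : C) :
  0 < r -> (forall z, z \in s -> `|z| < r) ->
  B * horner_mx A (\prod_(z <- s) ('X - z%:P)) = 0 ->
  exists2 K, 0 <= K & forall m i j, `|(B * A ^+ m) i j| <= K * r ^+ m.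
Proof.
move=> r0; elim: s B => [|z s IHs] B zr.
  rewrite big_nil rmorph1 mulr1 => ->.
  by exists 0 => // m i j; rewrite mul0r mxE normr0 mul0r.
rewrite big_cons rmorphM/= mulrA => /IHs[w ws|K K0 BK].
  by apply: zr; rewrite inE ws orbT.
have rz : 0 < r - `|z| by rewrite subr_gt0 zr// mem_head.
have S0 : 0 <= \sum_i \sum_j `|B i j|.
  by rewrite sumr_ge0// => i _; exact: sumr_ge0.
have Kz0 : 0 <= K / (r - `|z|) by rewrite divr_ge0// ltW.
(* The first term [S] bounds the entries at [m = 0]. The second, [Q], absorbs the source term: K =
   (r - |z|) Q, so |z| (S + Q) + K = |z| S + r Q <= r (S + Q). *)
exists (\sum_i \sum_j `|B i j| + K / (r - `|z|)); first exact: addr_ge0.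
elim=> [|m IHm] i j.
  rewrite expr0 !mulr1 ler_wpDr// (bigD1 i)//= (bigD1 j)//= -addrA lerDl.
  by rewrite addr_ge0 ?sumr_ge0// => i' _; exact: sumr_ge0.
have -> : B * A ^+ m.+1 = z *: (B * A ^+ m) +
    B * horner_mx A ('X - z%:P) * A ^+ m.
  rewrite rmorphB/= horner_mx_X horner_mx_C mulrBr mulrBl exprS mulrA.
  by rewrite -scalemx1 -scalerAr -scalerAl mulr1 addrC subrK.
rewrite mxE [X in X + _]mxE (le_trans (ler_normD _ _))// normrM.
rewrite (le_trans (lerD (ler_wpM2l (normr_ge0 z) (IHm i j)) (BK m i j)))//.
rewrite exprS mulrA -mulrDl mulrA ler_pM2r ?exprn_gt0//.
set S := \sum_i _ in S0 *.
set Q := K / _ in Kz0 *; have KE : K = (r - `|z|) * Q by rewrite mulrC divfK// gt_eqF.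
rewrite -subr_ge0.
rewrite [leRHS](_ : _ = S * (r - `|z|)); last by rewrite KE; ring.
by rewrite mulr_ge0// ltW.
Qed.

(** A supremum dominates the elements only of a set that is bounded above. The eigenvalues are among
    the roots of the characteristic polynomial, so the sum of the moduli of these roots is a
    bound. *)
Lemma eigenvalue_le_spectral_radius (R : realType) n (A : 'M[R]_n) (z : R[i]) :
  eigenvalue (map_mx (real_complex R) A) z ->
  ComplexField.Normc.normc z <= spectral_radius A.
Proof.
move=> Az; apply: ub_le_sup; last by exists z.
set A' := map_mx _ A in Az *.
have [s sE] := closed_field_poly_normal (char_poly A').
have rootE w : eigenvalue A' w -> w \in s.
  rewrite eigenvalue_root_char sE (monicP (char_poly_monic _)) scale1r.
  by rewrite root_prod_XsubC.
exists (\sum_(w <- s) ComplexField.Normc.normc w) => _ [w /rootE ws <-].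
rewrite (big_rem w)//= lerDl sumr_ge0// => u _; case: u => a b.
exact: sqrtr_ge0.
Qed.

(** The annihilation lemma is applied over the complex numbers with [B = 1]: by Cayley-Hamilton the
    product of the X - z over the eigenvalues kills [A], and every |z| is at most the spectral
    radius. *)
Lemma expmx_geometric (R : realType) n (A : 'M[R]_n.+1) :
  spectral_radius A < 1 ->
  exists K r : R, [/\ 0 <= K, 0 < r < 1 &
    forall m i j, `|(A ^+ m) i j| <= K * r ^+ m].
Proof.
move=> rho1; pose A' := map_mx (real_complex R) A.
set rho := spectral_radius A in rho1 *; pose m := Num.max 0 rho.
have m1 : m < 1 by rewrite gt_max ltr01.
have m0 : 0 <= m by rewrite le_max lexx.
have rhom : rho <= m by rewrite le_max lexx orbT.
(* The rate lies strictly between the spectral radius and 1; the maximum with 0 makes it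
   positive. *)
pose r := (1 + m) / 2.
have r0 : 0 < r by rewrite /r; lra.
have r1 : r < 1 by rewrite /r; lra.
have rhor : rho < r by rewrite /r; lra.
have [s sE] := closed_field_poly_normal (char_poly A').
have sA : \prod_(z <- s) ('X - z%:P) = char_poly A'.
  by rewrite sE (monicP (char_poly_monic _)) scale1r.
have [||| K K0 AK] := @annihilated_expmx_geometric _ _ A' 1 s (real_complex R r).
- by rewrite ltcR.
- move=> z zs; have : eigenvalue A' z.
    by rewrite eigenvalue_root_char -sA root_prod_XsubC.
  move=> /eigenvalue_le_spectral_radius zrho.
  by rewrite /Num.norm/= ltcR; exact: le_lt_trans rhor.
- by rewrite sA Cayley_Hamilton mulr0.
(* [K] is a complex number but, being nonnegative, it is real. *)
have [k kE] : exists k, K = real_complex R k.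
  by apply/complex_realP; exact: ger0_real.
move: K0 AK; rewrite kE ler0c => k0 AK; exists k, r; split => //.
  by rewrite r0 r1.
move=> l i j; have := AK l i j; rewrite mul1r /A' -rmorphXn/= mxE.
rewrite -rmorphXn -rmorphM normc_def /= lecR expr0n/= addr0.
by rewrite sqrtr_sqr.
Qed.

Lemma iter_mulmx_geometric (R : realType) k (A : 'M[R]_k) (b : 'cV[R]_k) :
  (0 < k)%N -> spectral_radius A < 1 ->
  exists K r : R, [/\ 0 <= K, 0 < r < 1 &
    forall m j, `|iter m (mulmx A) b j 0| <= K * r ^+ m].
Proof.
case: k A b => // k A b _ /expmx_geometric[K [r [K0 r01 AK]]].
exists (K * norm1 b), r; split => //.
  by rewrite mulr_ge0// sumr_ge0.
move=> m j; have -> : iter m (mulmx A) b = A ^+ m *m b.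
  elim: m => [|m IHm]; first by rewrite expr0 mul1mx.
  by rewrite iterS IHm exprS -mulmxE mulmxA.
rewrite mxE (le_trans (ler_norm_sum _ _ _))// mulrAC /norm1 mulr_sumr.
by apply: ler_sum => i _; rewrite normrM ler_wpM2r.
Qed.

(** * Independence of the past and the present *)

Section sigma_family.
Context (I : choiceType) (aT : Type) (d : measure_display)
  (rT : measurableType d) (D : set I) (f : I -> aT -> rT).

(** The finite-dimensional events: a pi-system that generates [sigma_family D f] and on which
    independence is expressed. *)
Definition cylinders : set (set aT) :=
  [set A | exists (J : {fset I}) (B : I -> set rT),
    [/\ forall i, i \in J -> D i, forall i, i \in J -> measurable (B i) &
        A = \bigcap_(i in [set` J]) (f i @^-1` B i)]].

Lemma setI_closed_cylinders : setI_closed cylinders.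
Proof.
move=> _ _ [J [B [JD mB ->]]] [J' [B' [JD' mB' ->]]].
(* Padding with [setT] writes both cylinders over the union of their index sets. *)
pose B2 i := (if i \in J then B i else setT) `&`
             (if i \in J' then B' i else setT).
exists (J `|` J')%fset, B2; split.
- by move=> i; rewrite in_fsetU => /orP[/JD|/JD'].
- move=> i _; apply: measurableI.
    by case: ifPn => // /mB.
  by case: ifPn => // /mB'.
- apply/seteqP; split=> [w [wJ wJ'] i _|w wJJ'].
    by split; case: ifPn => // iJ; [exact: wJ|exact: wJ'].
  split=> i /= iJ; have [] := wJJ' i.
  + by rewrite /= in_fsetU iJ.
  + by rewrite iJ.
  + by rewrite /= in_fsetU iJ orbT.
  + by rewrite iJ.
Qed.

Lemma sub_sigma_family_cylinders : sigma_family D f `<=` <<s cylinders >>.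
Proof.
apply: smallest_sub; first exact: smallest_sigma_algebra.
move=> A [i Di [B mB <-]]; apply: sub_sigma_algebra.
exists [fset i]%fset, (fun=> B); split => //.
  by move=> j; rewrite in_fset1 => /eqP ->.
rewrite setTI; apply/seteqP; split=> [w Bw j /=|w].
  by rewrite in_fset1 => /eqP ->.
by apply => /=; rewrite in_fset1.
Qed.

Lemma cylinders_measurable (d' : measure_display) (T : measurableType d')
    (p : T -> aT) :
  (forall i, D i -> measurable_fun setT (f i \o p)) ->
  forall A, cylinders A -> measurable (p @^-1` A).
Proof.
move=> mf _ [J [B [JD mB ->]]]; rewrite preimage_bigcap.
apply: fin_bigcap_measurable => [|i iJ]; first exact: finite_fset.
rewrite -[X in measurable X]setTI -comp_preimage.
by apply: mf => //; [exact: JD|exact: mB].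
Qed.

Lemma sigma_family_preimage (d' : measure_display) (T : measurableType d')
    (p : T -> aT) :
  (forall i, D i -> measurable_fun setT (f i \o p)) ->
  forall A, sigma_family D f A -> measurable (p @^-1` A).
Proof.
move=> mf; apply: smallest_sub => [|A [i Di [B mB <-]]].
  split=> [|A mA|F mF].
  - by rewrite preimage_set0.
  - by rewrite setTD preimage_setC; exact: measurableC.
  - by rewrite preimage_bigcup; exact: bigcup_measurable.
by rewrite setTI -comp_preimage -[X in measurable X]setTI; exact: mf.
Qed.

End sigma_family.

Lemma sigma_family_measurable (I : choiceType) (d d' : measure_display)
    (T : measurableType d) (rT : measurableType d') (D : set I)
    (f : I -> T -> rT) :
  (forall i, D i -> measurable_fun setT (f i)) ->
  sigma_family D f `<=` measurable.
Proof. by move=> mf A; exact: (@sigma_family_preimage _ _ _ _ _ _ _ T id). Qed.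

(** Dynkin's pi-lambda theorem; the whole space is the cylinder over the empty set of indices, so
    that finiteness of [m1] gives the exhausting sequence. *)
Lemma sigma_family_measure_unique (I : choiceType) (d d' : measure_display)
    (T : measurableType d) (rT : measurableType d') (R : realType)
    (D : set I) (f : I -> T -> rT) (m1 m2 : {measure set T -> \bar R}) :
  (forall i, D i -> measurable_fun setT (f i)) -> (m1 setT < +oo)%E ->
  (forall A, cylinders D f A -> m1 A = m2 A) ->
  forall A, sigma_family D f A -> m1 A = m2 A.
Proof.
move=> mf m1oo m12 A /sub_sigma_family_cylinders.
apply: (g_sigma_algebra_measure_unique (cylinders D f) _ (fun=> setT)) => //.
- exact: (@cylinders_measurable _ _ _ _ _ _ _ T id).
- move=> _; exists fset0, (fun=> setT); split => //.
  by apply/seteqP; split=> // w _ i /=; rewrite in_fset0.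
- by rewrite bigcup_const//; exists 0%N.
- exact: setI_closed_cylinders.
Qed.

Lemma sub_sigma_family (I : Type) (aT : Type) (d : measure_display)
    (rT : measurableType d) (D D' : set I) (f : I -> aT -> rT) :
  D `<=` D' -> sigma_family D f `<=` sigma_family D' f.
Proof.
move=> DD'; apply: sub_sigma_algebra2 => A [i Di ?].
by exists i => //; exact: DD'.
Qed.

Section iid_sequences.
Context (d : measure_display) (T : measurableType d) (R : realType)
  (P : probability T R) (dG : measure_display) (G : measurableType dG)
  (eps : int -> {RV P >-> G}).

Lemma measurable_noise s : measurable_fun setT (eps s : T -> G).
Proof. exact: measurable_funP. Qed.

(** The noise strictly before [t]. This is the generating class rather than the sigma-algebra, so
    that [g_sigma_algebraType (past t)] turns [T] into a space whose measurable functions are those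
    of the past. *)
Definition past (t : int) : set (set T) :=
  \bigcup_(s in [set s | s < t]) preimage_set_system setT (eps s) measurable.

Lemma past_measurable t : <<s past t >> `<=` @measurable _ T.
Proof. by apply: sigma_family_measurable => s _; exact: measurable_noise. Qed.

(** For fixed [B], both sides are finite measures in [A]: the restriction of [P] to an event and a
    multiple of [P]. They agree on the cylinders over indices before [t], hence on the sigma-algebra
    of the past. *)
Lemma past_indep t A B : mutually_independent eps ->
  <<s past t >> A -> measurable B ->
  P (A `&` eps t @^-1` B) = (P A * P (eps t @^-1` B))%E.
Proof.
move=> ieps pA mB.
have mtB : measurable (eps t @^-1` B).
  by rewrite -[X in measurable X]setTI; exact: measurable_noise.
have c0 : 0 <= fine (P (eps t @^-1` B)) by rewrite fine_ge0.
have cE : (fine (P (eps t @^-1` B)))%:E = P (eps t @^-1` B).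
  by rewrite fineK// fin_num_measure.
have scaleE X : mscale (NngNum c0) P X = (P X * P (eps t @^-1` B))%E.
  by rewrite /mscale/= cE muleC.
rewrite -scaleE; apply: (@sigma_family_measure_unique _ _ _ T G R
  [set s : int | s < t] (fun s => eps s : T -> G) (mrestr P mtB)) pA => //.
  by rewrite /= /mrestr -ge0_fin_numE// fin_num_measure//= setTI.
move=> _ [J [B' [JD mB' ->]]].
have tJ : t \notin J by apply/negP => /JD /=; rewrite ltxx.
have JE s : s \in J -> (if s == t then B else B' s) = B' s.
  by move=> sJ; case: eqP => // st; rewrite st (negbTE tJ) in sJ.
apply: etrans (esym (scaleE _)); rewrite /= /mrestr.
(* The intersection is one cylinder, with [B] placed at the new index [t], and mutual independence
   factorizes it. *)
transitivity (P (\bigcap_(s in [set` (t |` J)%fset])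
    (eps s @^-1` (if s == t then B else B' s)))).
  congr (P _); apply/seteqP; split=> [w [wJ wt] s /=|w wJ].
    by rewrite in_fset1U => /orP[/eqP ->|sJ]; rewrite ?eqxx// JE//; exact: wJ.
  split=> [s /= sJ|]; last by have := wJ t; rewrite /= fset1U1 eqxx; exact.
  by have := wJ s; rewrite /= in_fset1U sJ orbT JE//; exact.
rewrite ieps => [|s]; last first.
  rewrite in_fset1U => /orP[/eqP ->|sJ]; first by rewrite eqxx.
  by rewrite JE//; exact: mB'.
rewrite big_fsetU1//= eqxx muleC; congr (_ * _)%E.
by rewrite ieps//; apply: eq_big_seq => s sJ; rewrite JE.
Qed.

(** Both sides are values of laws on the space of noise trajectories, so it suffices to compare them
    on cylinders, where each is the product of the marginal probabilities. *)
Lemma iid_shift (h : int) (B : set (int -> G)) : iid eps ->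
  sigma_family setT (fun (t : int) (e : int -> G) => e t) B ->
  P ((fun w t => eps (t + h) w) @^-1` B) = P ((fun w t => eps t w) @^-1` B).
Proof.
move=> [ieps ideps].
pose coord (t : int) (e : int -> G) := e t.
pose Omega := g_sigma_algebraType
  (\bigcup_(t in [set: int]) preimage_set_system setT (coord t) measurable).
have mcoord t : measurable_fun setT (coord t : Omega -> G).
  by move=> _ C mC; apply: sub_sigma_algebra; exists t => //; exists C.
pose p (l : int) (w : T) : Omega := fun t => eps (t + l) w.
have mp l : measurable_fun setT (p l).
  move=> _ C mC; rewrite setTI.
  apply: (sigma_family_preimage (D := setT) (f := coord)) mC => t _.
  exact: (measurable_noise (t + l)).
have -> : (fun w t => eps t w) = p 0.
  by apply/funext => w; apply/funext => t; rewrite /p addr0.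
pose X l : {mfun T >-> Omega} := mfun_Sub (mem_set (mp l)).
apply: (@sigma_family_measure_unique _ _ _ Omega G R setT coord
  (distribution P (X h)) (distribution P (X 0))) => //.
  apply: (@le_lt_trans _ _ 1%E); last exact: ltry.
  exact: (@probability_le1 _ _ _ (distribution P (X h)) setT measurableT).
move=> _ [J [C [_ mC ->]]]; rewrite /distribution/= /pushforward.
have cylE l : P (p l @^-1` (\bigcap_(i in [set` J]) coord i @^-1` C i)) =
    (\prod_(t <- J) P (eps t @^-1` C t))%E.
  (* A cylinder for the noise shifted by [l] is a cylinder for the noise over the translated
     indices. *)
  transitivity (P (\bigcap_(s in [set` ((fun t : int => (t + l)%R) @` J)%fset])
      (eps s @^-1` C (s - l)))).
    congr (P _); apply/seteqP; split=> [w wJ s /= /imfsetP[t /= tJ ->]|w wJ t tJ].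
      by rewrite addrK; exact: wJ.
    have := wJ (t + l); rewrite /= addrK; apply.
    by apply/imfsetP; exists t.
  rewrite ieps => [|_ /imfsetP[t /= tJ ->]]; last by rewrite addrK; exact: mC.
  rewrite big_imfset/= => [|? ? _ _]; last exact: addIr.
  by apply: eq_big_seq => t tJ; rewrite addrK; exact/ideps/mC.
exact: etrans (cylE h) (esym (cylE 0)).
Qed.

Section past_integral.
Local Open Scope ereal_scope.
Context (dS : measure_display) (S : measurableType dS)
  (h : S * G -> \bar R) (mh : measurable_fun [set: S * G] h) (h0 : forall x, 0 <= h x).

Lemma measurable_fun_noise_integral t :
  measurable_fun setT (fun y => \int[P]_w h (y, eps t w)).
Proof.
have -> : (fun y => \int[P]_w h (y, eps t w)) =
    (fun y => \int[distribution P (eps t)]_g h (y, g)).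
  apply/funext => y; rewrite ge0_integral_distribution//.
  exact: measurableT_comp mh _.
exact: measurable_fun_fubini_tonelli_F.
Qed.

Lemma noise_integral_id s t y : identically_distributed eps ->
  \int[P]_w h (y, eps s w) = \int[P]_w h (y, eps t w).
Proof.
move=> ideps.
transitivity (\int[distribution P (eps s)]_g h (y, g)).
  rewrite ge0_integral_distribution//; exact: measurableT_comp mh _.
transitivity (\int[distribution P (eps t)]_g h (y, g)).
  by apply: eq_measure_integral => B mB _; exact: ideps.
rewrite ge0_integral_distribution//; exact: measurableT_comp mh _.
Qed.

(** This plays the role of conditioning on the past: independence makes the joint law of [V] and
    [eps t] a product, and Tonelli's theorem integrates the noise out. The innovation is then moved
    to time 1, where (A2) and (A3) are stated. *)
Lemma past_integral t (V : T -> S) : iid eps ->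
  (forall B, measurable B -> <<s past t >> (V @^-1` B)) ->
  \int[P]_w h (V w, eps t w) = \int[P]_w \int[P]_w' h (V w, eps 1 w').
Proof.
move=> [ieps ideps] pV.
have mV : measurable_fun setT V.
  by move=> _ B mB; rewrite setTI; apply: (@past_measurable t); exact: pV.
have mVe : measurable_fun setT (fun w => (V w, eps t w)).
  exact: measurable_fun_pair mV (measurable_noise t).
pose V' : {mfun T >-> S} := mfun_Sub (mem_set mV).
pose Ve : {mfun T >-> (S * G)%type} := mfun_Sub (mem_set mVe).
transitivity (\int[distribution P Ve]_z h z).
  by rewrite ge0_integral_distribution.
transitivity (\int[distribution P V' \x distribution P (eps t)]_z h z).
  apply: eq_measure_integral => C mC _; apply/esym.
  apply: product_measure_unique mC => A B mA mB.
  rewrite /distribution/= /pushforward.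
  by rewrite -(past_indep ieps (pV A mA) mB).
rewrite fubini_tonelli1//= /fubini_F ge0_integral_distribution//=; first last.
- by move=> y; exact: integral_ge0.
- exact: measurable_fun_fubini_tonelli_F.
apply: eq_integral => w _; rewrite -(noise_integral_id t 1 _ ideps).
rewrite ge0_integral_distribution//; exact: measurableT_comp mh _.
Qed.

(** The bound is asked only on [D], where [V] takes its values, because (A2) and (A3) concern only
    tuples of points of [E]. *)
Lemma past_integral_le t (V : T -> S) (D : set S) (b : S -> \bar R) : iid eps ->
  (forall B, measurable B -> <<s past t >> (V @^-1` B)) ->
  (forall w, D (V w)) -> measurable_fun setT b -> (forall y, 0 <= b y) ->
  (forall y, D y -> \int[P]_w h (y, eps 1 w) <= b y) ->
  \int[P]_w h (V w, eps t w) <= \int[P]_w b (V w).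
Proof.
move=> ieps pV DV mb b0 hb; rewrite past_integral//.
have mV : measurable_fun setT V.
  by move=> _ B mB; rewrite setTI; apply: (@past_measurable t); exact: pV.
apply: ge0_le_integral => //.
- by move=> w _; exact: integral_ge0.
- exact: measurableT_comp (measurable_fun_noise_integral 1) mV.
- exact: measurableT_comp mb mV.
- by move=> w _; exact: hb.
Qed.

End past_integral.

End iid_sequences.

(** * Borel sets and norms on vectors *)

Section borel_vectors.
Context (R : realType) (k : nat).
Implicit Types (E : set 'cV[R]_k) (x y : 'cV[R]_k).

Lemma closed_borelV E : closed E -> measurable (E : set (borelV R k)).
Proof.
move=> cE; rewrite -[E]setCK; apply: measurableC.
by apply: sub_sigma_algebra; exact: closed_openC.
Qed.

(** Meant for the components of phi, which are continuous on [E] only: the preimage of an open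
    interval is the trace on [E] of an open set. *)
Lemma measurable_within_borelV E (f : 'cV[R]_k -> R) : closed E ->
  {within E, continuous f} -> measurable_fun (E : set (borelV R k)) f.
Proof.
move=> cE /continuousP cf.
apply: (measurability _ (RGenOpens.measurableE R)) => _ [_ [a [b ->] <-]].
have /open_subspaceP[V oV VE] : open (from_subspace E f @^-1` `]a, b[).
  exact/cf/interval_open.
rewrite setIC -VE; apply: measurableI; last exact: closed_borelV.
exact: sub_sigma_algebra.
Qed.

Lemma measurable_borelV (f : 'cV[R]_k -> R) : continuous f ->
  measurable_fun [set: borelV R k] f.
Proof.
move=> cf; apply: measurable_within_borelV; first exact: closedT.
by apply: continuous_subspaceT.
Qed.

Lemma measurable_coord j : measurable_fun [set: borelV R k] (fun x => x j 0 : R).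
Proof. by apply: measurable_borelV; exact: coord_continuous. Qed.

(* For [C] closed, [f w] is in [C] iff, for every [m], the points [f_ n w] are
   eventually at distance less than [m.+1%:R^-1] of [C]. *)
Lemma measurable_fun_cvg_borelV d (T : measurableType d)
    (f_ : nat -> T -> borelV R k) (f : T -> borelV R k) :
  (forall n, measurable_fun setT (f_ n)) ->
  (forall w, (f_ n w : 'cV[R]_k) @[n --> \oo] --> (f w : 'cV[R]_k)) ->
  measurable_fun setT f.
Proof.
move=> mf ff.
apply: (@measurability _ _ T (borelV R k) setT f (@open 'cV[R]_k)) => // _ [U oU <-].
rewrite setTI -[f @^-1` U]setCK preimage_setC; apply: measurableC.
have := open_closedC oU; move: (~` U) => C cC.
pose C_ m := \bigcup_(x in C) (ball x (m.+1%:R^-1 : R))^°.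
have oC m : open (C_ m : set 'cV[R]_k).
  by apply: bigcup_open => x _; exact: open_interior.
have -> : f @^-1` C =
    \bigcap_m \bigcup_n \bigcap_(i in [set i | (n <= i)%N]) (f_ i @^-1` C_ m).
  apply/seteqP; split=> [w Cw m _|w /= Cw].
    have /(ff w)[n _ nC] : nbhs (f w : 'cV[R]_k) (C_ m).
      apply: open_nbhs_nbhs; split; first exact: oC.
      by exists (f w) => //; apply: nbhs_singleton; apply: nbhs_interior;
        exact: nbhsx_ballx.
    by exists n => // i /= ni; exact: nC.
  (* For the converse, a point of [C] is found within [e] of [f w]: half of [e] comes from the
     convergence of [f_] and half from membership in [C_ m]. *)
  apply: cC => B /nbhs_ballP[e /= e0 eB].
  have e20 : 0 < e / 2 by rewrite divr_gt0.
  have [m _ /(_ m (leqnn _)) me] := near_infty_natSinv_lt (PosNum e20).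
  have [n _ nC] := Cw m I.
  have [l _ lf] := ff w _ (nbhsx_ballx (f w : 'cV[R]_k) (e / 2) e20).
  have [x Cx /interior_subset xf] := nC (maxn n l) (leq_maxl _ _).
  exists x; split=> //; apply: eB; rewrite (splitr e).
  apply: ball_triangle (lf _ (leq_maxr _ _)) _; apply: ball_sym.
  exact: le_ball (ltW me) _ xf.
apply: bigcapT_measurable => m; apply: bigcupT_measurable => n.
apply: bigcap_measurableType => i _; rewrite -[X in measurable X]setTI.
by apply: mf => //; exact: sub_sigma_algebra.
Qed.

Lemma entry_le_norm (m n : nat) (A : 'M[R]_(m, n)) i j : `|A i j| <= `|A|.
Proof.
by rewrite [leRHS]/Num.norm/= mx_normrE; apply/bigmax_geP; right; exists (i, j).
Qed.

Variables (N : 'cV[R]_k -> R) (hN : is_norm N).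

Lemma normN0 : N 0 = 0.
Proof. by case: hN => _ NZ _; rewrite -(scale0r 0) NZ normr0 mul0r. Qed.

Lemma normNN x : N (- x) = N x.
Proof. by case: hN => _ NZ _; rewrite -scaleN1r NZ normrN normr1 mul1r. Qed.

Lemma norm_ge0N x : 0 <= N x.
Proof.
(* From 0 = N (x - x) <= N x + N (- x) = 2 N x. *)
case: hN => ND _ _; have := ND x (- x); rewrite subrr normN0 normNN.
by rewrite -mulr2n pmulrn_lge0.
Qed.

(** Expansion in the canonical basis: [N] is at most a constant multiple of the sup norm. *)
Lemma normN_le x (b : R) : (forall j, `|x j 0| <= b) ->
  N x <= \sum_j N (delta_mx j 0) * b.
Proof.
case: (hN) => ND NZ _ xb.
have -> : x = \sum_j x j 0 *: delta_mx j 0.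
  by rewrite [LHS]matrix_sum_delta; apply: eq_bigr => j _; rewrite big_ord1.
elim/big_ind2 : _ => [|u a v c ua vc|j _]; first by rewrite normN0.
  by rewrite (le_trans (ND _ _))// lerD.
by rewrite NZ mulrC ler_wpM2l// norm_ge0N.
Qed.

Lemma normN_continuous : continuous N.
Proof.
move=> x; case: (hN) => ND _ _.
(* The [+ 1] makes [c] positive, so that [e / c] is a radius. *)
pose c := \sum_j N (delta_mx j 0) + 1.
have c0 : 0 < c by rewrite ltr_wpDl// sumr_ge0// => j _; exact: norm_ge0N.
apply/(@cvgrPdist_le _ _ _ (nbhs x) (nbhs_filter x)) => e e0.
have ec0 : 0 < e / c by exact: divr_gt0.
apply: filterS (nbhsx_ballx x (e / c) ec0) => y.
rewrite -ball_normE /= => xy.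
have xye : forall z, z = x - y \/ z = y - x -> N z <= e.
  move=> z zxy; rewrite (le_trans (@normN_le z (e / c) _))//.
    move=> j; have -> : `|z j 0| = `|(x - y) j 0|.
      by case: zxy => -> //; rewrite !mxE distrC.
    by rewrite (le_trans (entry_le_norm _ _ _))// ltW.
  rewrite -mulr_suml mulrCA ler_piMr ?(ltW e0)//.
  by rewrite ler_pdivrMr// mul1r lerDl.
rewrite ler_distl; apply/andP; split.
  rewrite lerBlDr -[in leLHS](subrK x y); rewrite (le_trans (ND _ _))// addrC lerD2l.
  by apply: xye; right.
rewrite -[in leLHS](subrK y x) (le_trans (ND _ _))// addrC lerD2l.
by apply: xye; left.
Qed.

Lemma trmx_continuous (m n : nat) : continuous (@trmx R m n).
Proof.
move=> A; apply/(@cvg_ballP _ _ _ (nbhs A) (nbhs_filter A)) => e e0.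
apply: filterS (nbhsx_ballx A e e0) => B [_ AB].
by split => // i j; rewrite !mxE.
Qed.

(** The other half of the equivalence of norms: [N] is continuous, so it attains on the compact unit
    sphere of the sup norm a minimum, which is positive by definiteness; homogeneity does the rest.
    The sphere is taken among row vectors, hence the transpositions. *)
Lemma entry_le_normN : exists2 c, 0 <= c & forall x j, `|x j 0| <= c * N x.
Proof.
(* If all vectors are zero the sphere is empty; the constant 0 then suffices. *)
have [[x x0]|all0] := pselect (exists x : 'cV[R]_k, x != 0); last first.
  exists 0 => // x j; rewrite mul0r; have [->|x0] := eqVneq x 0.
    by rewrite mxE normr0.
  by case: all0; exists x.
pose S := [set v : 'rV[R]_k | `|v| = 1].
have normT (y : 'cV[R]_k) : `|y^T| = `|y|.
  apply/eqP; rewrite eq_le; apply/andP; split.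
    rewrite [leLHS]/Num.norm/= mx_normrE; apply/bigmax_leP; split => // i _.
    by rewrite mxE entry_le_norm.
  rewrite [leLHS]/Num.norm/= mx_normrE; apply/bigmax_leP; split => // i _.
  by rewrite -[X in `|X|](mxE trmx_key (fun i j => y j i)) entry_le_norm.
have unit (y : 'cV[R]_k) : y != 0 -> S (`|y|^-1 *: y)^T.
  move=> y0; rewrite /S/= normT normrZ normfV normr_id mulVf//.
  by rewrite normr_eq0.
have cS : compact S.
  apply: bounded_closed_compact.
    by exists 1; split => // M M1 v /= ->; exact: ltW.
  apply: (@closed_comp _ _ (fun v : 'rV[R]_k => `|v|) [set 1]) => [v _|].
    exact: norm_continuous.
  exact: closed_eq.
have [||v Sv minv] := @EVT_min_rV R k (N \o trmx) S _ cS.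
- by exists (`|x|^-1 *: x)^T; exact: unit.
- apply: continuous_subspaceT => v; apply: continuous_comp.
    exact: trmx_continuous.
  exact: normN_continuous.
have Nv0 : 0 < N v^T.
  rewrite lt_neqAle norm_ge0N andbT eq_sym; apply/eqP.
  case: (hN) => _ _ N0 /N0 /(congr1 trmx); rewrite trmxK trmx0 => v0.
  move: Sv; rewrite inE /S/= v0 normr0 => /eqP.
  by rewrite eq_sym oner_eq0.
exists (N v^T)^-1; first by rewrite invr_ge0 ltW.
move=> y j; rewrite (le_trans (entry_le_norm _ _ _))//.
have [->|y0] := eqVneq y 0; first by rewrite normr0 normN0 mulr0.
have := minv _ (mem_set (unit y y0)); rewrite /= trmxK.
case: (hN) => _ -> _; rewrite normfV normr_id => vy.
rewrite mulrC ler_pdivlMr// mulrC -ler_pdivlMr ?normr_gt0//.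
by rewrite mulrC.
Qed.

End borel_vectors.

(** * Convergence in mean *)

Lemma fatou_le d (T : measurableType d) (R : realType)
    (mu : {measure set T -> \bar R}) (f_ : nat -> T -> \bar R)
    (f : T -> \bar R) (M : \bar R) :
  (forall n, measurable_fun setT (f_ n)) -> (forall n w, (0 <= f_ n w)%E) ->
  (forall w, f_ n w @[n --> \oo] --> f w) ->
  (forall n, (\int[mu]_w f_ n w <= M)%E) -> (\int[mu]_w f w <= M)%E.
Proof.
move=> mf f0 ff fM.
have -> : (\int[mu]_w f w = \int[mu]_w limn_einf (f_ ^~ w))%E.
  apply: eq_integral => w _; apply/esym.
  by have /cvg_limn_einf_sup[] := ff w.
apply: (le_trans (fatou mu measurableT mf (fun n w _ => f0 n w))).
rewrite limn_einf_lim; apply: lime_le; first exact: is_cvg_einfs.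
apply: nearW => n; apply: (le_trans _ (fM n)).
by apply: ereal_inf_lbound; exists n => //=.
Qed.

Lemma le_geometric_eq0 (R : realType) (C r : R) (x : \bar R) :
  0 < r < 1 -> (0 <= x)%E -> (forall n, (x <= (C * r ^+ n)%:E)%E) -> x = 0%E.
Proof.
move=> /andP[r0 r1] x0 xC; apply/eqP; rewrite eq_le x0 andbT.
have : (fun n => (C * r ^+ n)%:E) @ \oo --> 0%:E.
  apply: cvg_EFin; first by apply: nearW.
  rewrite -[X in _ --> X](mulr0 C); apply: cvgMr; apply: cvg_expr.
  by rewrite gtr0_norm.
by apply: cvge_ge; exact: nearW.
Qed.

Section mean_distance.
Context d (T : measurableType d) (R : realType) (P : probability T R) (k : nat).
Implicit Types (j : 'I_k) (Y Z W : T -> borelV R k).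

(** Kept coordinate by coordinate, since the matrices of (A2) act on the vector of these L^1
    distances. *)
Definition mean_dist j Y Z : \bar R :=
  \int[P]_w (`|(Y w : 'cV[R]_k) j 0 - (Z w : 'cV[R]_k) j 0|)%:E.

Lemma measurable_fun_dist j Y Z :
  measurable_fun setT Y -> measurable_fun setT Z ->
  measurable_fun setT
    (fun w => (`|(Y w : 'cV[R]_k) j 0 - (Z w : 'cV[R]_k) j 0|)%:E).
Proof.
move=> mY mZ; apply/measurable_EFinP; apply: measurableT_comp => //.
by apply: measurable_funB; apply: (measurableT_comp (measurable_coord j)).
Qed.

Lemma mean_dist_ge0 j Y Z : (0 <= mean_dist j Y Z)%E.
Proof. by apply: integral_ge0 => w _; rewrite lee_fin. Qed.

Lemma mean_distC j Y Z : mean_dist j Y Z = mean_dist j Z Y.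
Proof. by apply: eq_integral => w _; rewrite distrC. Qed.

Lemma mean_dist_triangle j Y Z W : measurable_fun setT Y -> measurable_fun setT Z ->
  measurable_fun setT W -> (mean_dist j Y W <= mean_dist j Y Z + mean_dist j Z W)%E.
Proof.
move=> mY mZ mW; rewrite /mean_dist -ge0_integralD//; first last.
- exact: measurable_fun_dist.
- exact: measurable_fun_dist.
apply: ge0_le_integral => //.
- exact: measurable_fun_dist.
- by apply: emeasurable_funD; exact: measurable_fun_dist.
- by move=> w _; rewrite -EFinD lee_fin ler_distD.
Qed.

Lemma mean_dist_ae_eq j Y Z W :
  measurable_fun setT Y -> measurable_fun setT Z -> measurable_fun setT W ->
  {ae P, forall w, Z w = W w} -> mean_dist j Y Z = mean_dist j Y W.
Proof.
move=> mY mZ mW ZW; apply: ae_eq_integral => //.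
- exact: measurable_fun_dist.
- exact: measurable_fun_dist.
- by apply: filterS ZW => w -> _.
Qed.

Lemma mean_dist0_ae_eq Y Z : measurable_fun setT Y -> measurable_fun setT Z ->
  (forall j, mean_dist j Y Z = 0%E) -> {ae P, forall w, Y w = Z w}.
Proof.
move=> mY mZ YZ0.
have YZ j : {ae P, forall w, (Y w : 'cV[R]_k) j 0 = (Z w : 'cV[R]_k) j 0}.
  pose f w := (((Y w : 'cV[R]_k) j 0 - (Z w : 'cV[R]_k) j 0)%:E)%E.
  have mf : measurable_fun setT f.
    apply/measurable_EFinP; apply: measurable_funB;
      exact: (measurableT_comp (measurable_coord j)).
  have /(ae_eq_integral_abs P measurableT mf) : (\int[P]_w `|f w| = 0)%E.
    exact: YZ0.
  by apply: filterS => w /(_ I) [] /eqP; rewrite subr_eq0 => /eqP.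
have : \forall w \near almost_everywhere P, forall j, (Y w : 'cV[R]_k) j 0 = (Z w : 'cV[R]_k) j 0.
  exact: filter_forall.
by apply: filterS => w YZw; apply/colP.
Qed.

End mean_distance.

(** * Truncated limits of sequences with summable increments *)

Section summable_increments.
Context (R : realType) (k : nat) (x0 : 'cV[R]_k).
Implicit Types (u : nat -> 'cV[R]_k).

Definition increment u n : R := \sum_j `|u n.+1 j 0 - u n j 0|.

Definition sum_increments u : \bar R := (\sum_(n <oo) (increment u n)%:E)%E.

(* Unlike [u], the sequence [trunc u] always converges. *)
Definition trunc u n : 'cV[R]_k :=
  if (sum_increments u < +oo)%E then u n else x0.

(** In the application [x0] is a point of [E], so that the limit lies in [E] everywhere and not just
    almost surely. *)
Definition trunc_lim u : 'cV[R]_k :=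
  if (sum_increments u < +oo)%E then \col_j limn (fun n => u n j 0) else x0.

Lemma increment_ge0 u n : 0 <= increment u n.
Proof. exact: sumr_ge0. Qed.

(** Each coordinate is a telescoping series whose terms are dominated by the increments, hence
    absolutely convergent. *)
Lemma coord_is_cvgn u j : (sum_increments u < +oo)%E ->
  cvgn (fun n => u n j 0).
Proof.
move=> uoo.
have tv0 : (0 <= sum_increments u)%E.
  by apply: nneseries_ge0 => n _ _; rewrite lee_fin increment_ge0.
have cincr : cvgn (series (increment u)).
  apply: nondecreasing_is_cvgn.
    apply/nondecreasing_seqP => n.
    by rewrite /series/= big_nat_recr//= lerDl increment_ge0.
  exists (fine (sum_increments u)) => _ [n _ <-].
  rewrite -lee_fin fineK ?ge0_fin_numE// /series/= -sumEFin.
  by apply: nneseries_lim_ge => i _ _; rewrite lee_fin increment_ge0.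
have ctel : cvgn (series (telescope (fun n => u n j 0))).
  apply: normed_cvg; apply: series_le_cvg cincr => n //=.
    exact: increment_ge0.
  by rewrite /increment (bigD1 j)//= lerDl sumr_ge0.
have -> : (fun n => u n j 0) =
    (fun n => u 0%N j 0 + series (telescope (fun n => u n j 0)) n).
  by apply/funext => n; rewrite telescopeK/= addrC subrK.
by apply: is_cvgD => //; exact: is_cvg_cst.
Qed.

Lemma trunc_cvg u : trunc u n @[n --> \oo] --> trunc_lim u.
Proof.
rewrite /trunc_lim; have [uoo|] := boolP (sum_increments u < +oo)%E; last first.
  move=> /negbTE uoo; have -> : trunc u = cst x0.
    by apply/funext => n; rewrite /trunc uoo.
  exact: cvg_cst.
have -> : trunc u = u by apply/funext => n; rewrite /trunc uoo.
apply/cvg_ballP => e e0.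
have ue j : \forall n \near \oo, ball (limn (fun n => u n j 0)) e (u n j 0).
  have uj : u n j 0 @[n --> \oo] --> limn (fun n => u n j 0).
    exact: coord_is_cvgn.
  by move/cvg_ballP : uj; apply.
have : \forall n \near \oo, forall j, ball (limn (fun n => u n j 0)) e (u n j 0).
  exact: filter_forall.
apply: filterS => n une; split=> // i j; rewrite mxE ord1; exact: une.
Qed.

Lemma trunc_coord_cvg u j :
  trunc u n j 0 @[n --> \oo] --> trunc_lim u j 0.
Proof.
apply: (@cvg_comp _ _ _ (trunc u) (fun x : 'cV[R]_k => x j 0) _ _ _
  (trunc_cvg (u := u))).
exact: coord_continuous.
Qed.

Lemma trunc_lim_closed (E : set 'cV[R]_k) u : closed E -> E x0 ->
  (forall n, E (u n)) -> E (trunc_lim u).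
Proof.
move=> cE Ex0 Eu; apply: (closed_cvg E cE _ _ (@trunc_cvg u)).
by apply: nearW => n; rewrite /trunc; case: ifP.
Qed.

Context d (T : measurableType d) (v : nat -> T -> borelV R k).
Hypothesis mv : forall n, measurable_fun setT (v n).

Lemma measurable_increment n :
  measurable_fun setT (fun w => increment (v ^~ w) n).
Proof.
apply: measurable_sum => j; apply: measurableT_comp => //.
by apply: measurable_funB; exact: (measurableT_comp (measurable_coord j)).
Qed.

Lemma measurable_sum_increments :
  measurable_fun setT (fun w => sum_increments (v ^~ w)).
Proof.
apply: ge0_emeasurable_sum => [n w _ _|n _].
  by rewrite lee_fin increment_ge0.
by apply/measurable_EFinP; exact: measurable_increment.
Qed.

Lemma measurable_trunc n :
  measurable_fun setT (fun w => trunc (v ^~ w) n : borelV R k).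
Proof.
apply: measurable_fun_if => //; last exact: measurable_funTS.
apply: (@measurable_fun_bool _ _ _ _ true).
by apply: measurable_lte => //; exact: measurable_sum_increments.
Qed.

Lemma measurable_trunc_lim :
  measurable_fun setT (fun w => trunc_lim (v ^~ w) : borelV R k).
Proof.
apply: (measurable_fun_cvg_borelV (fun n => measurable_trunc n)) => w.
exact: trunc_cvg.
Qed.

End summable_increments.

(** * Norms in L^r *)

(** For l > 0, the power is the exponential of r ln u. At l = 0, where the logarithm is not
    continuous, u^r <= u once u < 1, because r >= 1. *)
Lemma cvg_powR (R : realType) (r : R) (u : nat -> R) (l : R) : 1 <= r ->
  (forall n, 0 <= u n) -> u n @[n --> \oo] --> l ->
  u n `^ r @[n --> \oo] --> l `^ r.
Proof.
move=> r1 u0 ul; have r0 : 0 < r by exact: lt_le_trans r1.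
have l0 : 0 <= l by apply: (closed_cvg (fun x : R => 0 <= x) _ _ _ ul);
  [exact: closed_ge|exact: nearW].
have [ln0|] := ltP 0 l; last first.
  move=> /(conj l0)/andP/le_anti l_eq0.
  rewrite -{}l_eq0 in ul *; rewrite powR0 ?gt_eqF//.
  apply: (squeeze_cvgr _ (cvg_cst 0) ul).
  have : \forall n \near \oo, u n < 1 by exact: cvgr_lt ul _ ltr01.
  apply: filterS => n un1; rewrite powR_ge0/=.
  have [->|un0] := eqVneq (u n) 0; first by rewrite powR0// gt_eqF.
  rewrite -[leRHS]powRr1//; apply: ger_powR => //.
  by rewrite lt_neqAle eq_sym un0 u0 ltW.
have -> : l `^ r = expR (r * ln l) by rewrite /powR gt_eqF.
have : expR (r * ln (u n)) @[n --> \oo] --> expR (r * ln l).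
  apply: continuous_cvg; first exact: continuous_expR.
  by apply: cvgMr; apply: continuous_cvg ul; exact: continuous_ln.
apply: cvg_trans; apply: near_eq_cvg.
have : \forall n \near \oo, 0 < u n by exact: cvgr_gt ul _ ln0.
by apply: filterS => n un0; rewrite /powR gt_eqF.
Qed.

Section Lnorm_sum.
Context d (T : measurableType d) (R : realType) (P : probability T R).
Variables (r : R) (r1 : 1 <= r).
Implicit Types (f : T -> R) (b : R).

Local Notation nu f := (Lnorm P r%:E (fun w => (f w)%:E)).

(** The maps x^r and x^(1/r) are increasing on [0, +oo]. The norm suits Minkowski's inequality, the
    moment of order [r] suits Tonelli's theorem and Fatou's lemma. *)
Lemma Lnorm_le_powR f b : 0 <= b ->
  (nu f <= b%:E)%E <-> (\int[P]_w (`|f w| `^ r)%:E <= (b `^ r)%:E)%E.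
Proof.
move=> b0; have r0 : 0 < r by exact: lt_le_trans r1.
have NE : (nu f `^ r = \int[P]_w (`|f w| `^ r)%:E)%E.
  by rewrite poweR_Lnorm ?gt_eqF//; apply: eq_integral => w _.
have in0y (x : \bar R) : (0 <= x)%E -> x \in `[0%E, +oo%E].
  by move=> x0; rewrite in_itv/= x0 leey.
rewrite -NE -poweR_EFin; split=> [fb|].
  by apply: gt0_ler_poweR => //; [exact: ltW|apply: in0y; exact: Lnorm_ge0|exact: in0y].
move=> /(gt0_ler_poweR (r := r^-1)); rewrite -!poweRrM mulfV ?gt_eqF//.
rewrite !poweRe1 ?lee_fin ?Lnorm_ge0//; apply.
- by rewrite invr_ge0 ltW.
- by apply: in0y; exact: poweR_ge0.
- by apply: in0y; exact: poweR_ge0.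
Qed.

Lemma Lnorm_cst b : 0 <= b -> (nu (cst b) <= b%:E)%E.
Proof.
move=> b0; apply/Lnorm_le_powR => //=.
by rewrite integral_cst//= probability_setT mule1 ger0_norm.
Qed.

(** Minkowski's inequality by induction over the indices, and once more for the constant [c]. *)
Lemma Lnorm_weighted_sum (I : finType) (a b : I -> R) (f : I -> T -> R) (c : R) :
  0 <= c -> (forall i, 0 <= a i) -> (forall i, 0 <= b i) ->
  (forall i, measurable_fun setT (f i)) ->
  (forall i, (nu (f i) <= (b i)%:E)%E) ->
  (nu (fun w => c + \sum_i a i * f i w) <= (c + \sum_i a i * b i)%:E)%E.
Proof.
move=> c0 a0 b0 mf fb.
have mg (s : seq I) : measurable_fun setT (fun w => \sum_(i <- s) a i * f i w).
  by apply: measurable_sum => i; exact: measurable_funM.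
have Ns (s : seq I) : (nu (fun w => \sum_(i <- s) a i * f i w)%R <=
    (\sum_(i <- s) a i * b i)%:E)%E.
  elim: s => [|i s IHs].
    rewrite big_nil; under [X in Lnorm _ _ X]eq_fun do rewrite big_nil.
    exact: Lnorm_cst.
  under [X in Lnorm _ _ X]eq_fun do rewrite big_cons.
  rewrite big_cons.
  apply: (le_trans (minkowski_EFin P (f := fun w => a i * f i w) _ (mg s) r1)).
    exact: measurable_funM.
  rewrite EFinD; apply: leeD => //.
  (* Homogeneity of the norm is obtained from that of the moment of order [r]. *)
  apply/Lnorm_le_powR; first exact: mulr_ge0.
  rewrite powRM//.
  have -> : (\int[P]_w (`|a i * f i w| `^ r)%:E =
      (a i `^ r)%:E * \int[P]_w (`|f i w| `^ r)%:E)%E.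
    rewrite -ge0_integralZl_EFin//; last 2 first.
    - apply/measurable_EFinP.
      apply: (measurableT_comp (measurable_powR r)).
      exact: measurableT_comp.
    - exact: powR_ge0.
    apply: eq_integral => w _.
    by rewrite normrM (ger0_norm (a0 i)) powRM.
  rewrite EFinM lee_wpmul2l ?lee_fin ?powR_ge0//.
  exact/Lnorm_le_powR.
apply: (le_trans (minkowski_EFin P (f := cst c) _ (mg _) r1)) => //.
by rewrite EFinD; apply: leeD; [exact: Lnorm_cst|exact: Ns].
Qed.

End Lnorm_sum.

(** * The random recursion *)

Section random_recursion.
Context (R : realType) (d : measure_display) (T : measurableType d)
  (P : probability T R) (dG : measure_display) (G : measurableType dG)
  (k q : nat) (E : set 'cV[R]_k) (eps : int -> {RV P >-> G})
  (F : q.-tuple (borelV R k) * G -> borelV R k).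
Hypotheses (hEcl : closed E) (heps : iid eps)
  (hFE : forall y g, tuples_in E y -> E (F (y, g)))
  (hFm : measurable_fun (tuples_in E `*` [set: G]) F).
Variables (x0 : 'cV[R]_k) (Ex0 : E x0).
Implicit Types (Y Z : int -> T -> borelV R k).

Lemma measurable_tuples_in :
  measurable (tuples_in E : set (q.-tuple (borelV R k))).
Proof.
have -> : (tuples_in E : set (q.-tuple (borelV R k))) =
    \bigcap_(i in [set: 'I_q]) ((fun y => tnth y i) @^-1` E).
  by apply/seteqP; split=> y Ey => [i _|i]; [exact: Ey|exact: (Ey i I)].
apply: fin_bigcap_measurable => // i _; rewrite -[X in measurable X]setTI.
by apply: measurable_tnth => //; exact: closed_borelV.
Qed.

(* [F] is only assumed measurable on the tuples of points of [E]. *)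
Definition extF (yg : q.-tuple (borelV R k) * G) : borelV R k :=
  if yg.1 \in tuples_in E then F yg else x0.

Lemma extFE y g : tuples_in E y -> extF (y, g) = F (y, g).
Proof. by move=> Ey; rewrite /extF/= mem_set. Qed.

Lemma measurable_extF : measurable_fun setT extF.
Proof.
have mE : measurable (tuples_in E `*` [set: G] :
    set (q.-tuple (borelV R k) * G)).
  by apply: measurableX => //; exact: measurable_tuples_in.
have EE : tuples_in E `*` [set: G] =
    [set: q.-tuple (borelV R k) * G] `&`
      (fun yg => yg.1 \in tuples_in E) @^-1` [set true].
  rewrite setTI; apply/seteqP; split=> -[y g] /=.
    by case=> Ey _; exact: mem_set.
  by move=> /set_mem.
apply: measurable_fun_if => //; last by rewrite -EE.
by apply: (@measurable_fun_bool _ _ _ _ true); rewrite -EE.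
Qed.

Lemma measurable_recursion dS (S : measurableType dS)
    (V : S -> q.-tuple (borelV R k)) (e : S -> G) :
  measurable_fun setT V -> measurable_fun setT e ->
  (forall s, tuples_in E (V s)) -> measurable_fun setT (fun s => F (V s, e s)).
Proof.
move=> mV me EV.
have -> : (fun s => F (V s, e s)) = extF \o (fun s => (V s, e s)).
  by apply/funext => s /=; rewrite extFE.
by apply: measurableT_comp measurable_extF _; exact: measurable_fun_pair.
Qed.

(** [past] is strict, so [t + 1] allows the noise up to time [t] included. *)
Definition adapted Z := forall t B, measurable B ->
  <<s past eps (t + 1) >> (Z t @^-1` B).

Lemma adaptedP Z : non_anticipative eps Z <-> adapted Z.
Proof.
have pE t : past eps (t + 1) = \bigcup_(s in [set s : int | s <= t])
    preimage_set_system setT (eps s : T -> G) measurable.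
  by rewrite /past; congr bigcup; apply/seteqP; split=> s /=; rewrite ltzD1.
by split=> Zp t B mB; have := Zp t B mB; rewrite /sigma_family -pE.
Qed.

Lemma past_le t t' : t <= t' -> <<s past eps t >> `<=` <<s past eps t' >>.
Proof.
by move=> tt'; apply: sub_sigma_family => s /= st; exact: lt_le_trans tt'.
Qed.

Lemma adapted_measurable Z t : adapted Z -> measurable_fun setT (Z t).
Proof.
by move=> aZ _ B mB; rewrite setTI; apply: past_measurable (aZ t B mB).
Qed.

(** The most recent lag is at time [t - 1], so the vector of lags depends on the strict past only;
    this is what makes it independent of [eps t]. *)
Lemma lags_past Z t B : adapted Z -> measurable B ->
  <<s past eps t >> (lags q Z t @^-1` B).
Proof.
move=> aZ mB.
have mlags : measurable_fun setT
    (lags q Z t : g_sigma_algebraType (past eps t) -> q.-tuple (borelV R k)).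
  apply/measurable_fun_tnthP => i _ C mC; rewrite setTI.
  (* Lag [i] is at time t - (i + 1), whose information is the [past] of t - i. *)
  apply: (@past_le (t - (i.+1)%:Z + 1)).
    by rewrite -addrA gerDl -addn1 PoszD opprD addrNK oppr_le0.
  have := aZ (t - (i.+1)%:Z) C mC; congr (<<s _ >> _).
  by apply/seteqP; split=> w /=; rewrite tnth_mktuple.
by rewrite -[X in <<s _ >> X]setTI; exact: mlags.
Qed.

Lemma lags_in Z t w : (forall t w, E (Z t w)) -> tuples_in E (lags q Z t w).
Proof. by move=> EZ i; rewrite tnth_mktuple; exact: EZ. Qed.

Lemma adapted_recursion Z : adapted Z -> (forall t w, E (Z t w)) ->
  adapted (fun t w => F (lags q Z t w, eps t w)).
Proof.
move=> aZ EZ t B mB.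
have := @measurable_recursion _ (g_sigma_algebraType (past eps (t + 1)))
  (lags q Z t) (eps t) _ _ _ measurableT B mB; rewrite setTI; apply.
- move=> _ C mC; rewrite setTI; apply: (@past_le t); first by rewrite lerDl.
  exact: lags_past.
- move=> _ C mC; apply: sub_sigma_algebra; exists t => /=; first by rewrite ltzD1.
  by exists C.
- by move=> w; exact: lags_in.
Qed.

Lemma ge0_integral_weighted_sum (I : finType) (a : I -> R) (f : I -> T -> R) :
  (forall i, 0 <= a i) -> (forall i w, 0 <= f i w) ->
  (forall i, measurable_fun setT (f i)) ->
  (\int[P]_w (\sum_i a i * f i w)%:E = \sum_i (a i)%:E * \int[P]_w (f i w)%:E)%E.
Proof.
move=> a0 f0 mf; under eq_integral do rewrite -sumEFin.
rewrite ge0_integral_sum//; last 2 first.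
- by move=> i; apply/measurable_EFinP; apply: measurable_funM.
- by move=> i w _; rewrite lee_fin mulr_ge0.
apply: eq_bigr => i _; under eq_integral do rewrite EFinM.
rewrite ge0_integralZl_EFin//; first by move=> w _; rewrite lee_fin.
exact/measurable_EFinP.
Qed.

(** * Contraction in mean *)

Section contraction.
Variable A : 'I_q -> 'M[R]_k.
Hypotheses (A0 : forall i, nonneg_mx (A i))
  (A2 : forall y y' : q.-tuple (borelV R k), tuples_in E y -> tuples_in E y' ->
     vle (expectation_vec P (fun w =>
            vabs ((F (y, eps 1 w) : 'cV[R]_k) - F (y', eps 1 w))))
         (\sum_(i < q) A i *m vabs ((tnth y i : 'cV[R]_k) - tnth y' i))).

(** A bound uniform in time also controls the [q] lagged distances, so that only the sum of the A_i
    appears. (A2) is integrated over the past by taking for [V] the pair of lag vectors. *)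
Lemma contraction Y Z (b : 'cV[R]_k) : adapted Y -> adapted Z ->
  (forall t w, E (Y t w)) -> (forall t w, E (Z t w)) ->
  (forall s l, (mean_dist P l (Y s) (Z s) <= (b l 0)%:E)%E) ->
  forall t j, (mean_dist P j (fun w => F (lags q Y t w, eps t w))
                         (fun w => F (lags q Z t w, eps t w)) <=
               (((\sum_i A i) *m b) j 0)%:E)%E.
Proof.
move=> aY aZ EY EZ YZb t j.
pose S := (q.-tuple (borelV R k) * q.-tuple (borelV R k))%type.
pose V w : S := (lags q Y t w, lags q Z t w).
(* [extF] replaces [F], because [h] must be measurable on the whole product space. *)
pose h (yg : S * G) : \bar R := (`|(extF (yg.1.1, yg.2) : 'cV[R]_k) j 0 -
  (extF (yg.1.2, yg.2) : 'cV[R]_k) j 0|)%:E.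
(* Coordinate [j] of the right-hand side of (A2), as a single sum over pairs of a lag and a
   coordinate. *)
pose bnd (y : S) : R := \sum_(il : 'I_q * 'I_k) A il.1 j il.2 *
  `|(tnth y.1 il.1 : 'cV[R]_k) il.2 0 - (tnth y.2 il.1 : 'cV[R]_k) il.2 0|.
have mh : measurable_fun setT h.
  apply/measurable_EFinP; apply: measurableT_comp => //.
  apply: measurable_funB.
    apply: (measurableT_comp (measurable_coord j)).
    apply: measurableT_comp measurable_extF _; apply: measurable_fun_pair => //.
    exact: measurableT_comp.
  apply: (measurableT_comp (measurable_coord j)).
  apply: measurableT_comp measurable_extF _; apply: measurable_fun_pair => //.
  exact: measurableT_comp.
have mdis (il : 'I_q * 'I_k) : measurable_fun setT (fun y : S =>
  `|(tnth y.1 il.1 : 'cV[R]_k) il.2 0 - (tnth y.2 il.1 : 'cV[R]_k) il.2 0|).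
  apply: measurableT_comp => //; apply: measurable_funB;
    apply: (measurableT_comp (measurable_coord il.2));
    by apply: (measurableT_comp (measurable_tnth il.1)).
have mbnd : measurable_fun setT bnd.
  by apply: measurable_sum => il; apply: measurable_funM.
have pV B : measurable B -> <<s past eps t >> (V @^-1` B).
  move=> mB; rewrite -[X in <<s _ >> X]setTI.
  apply: (@measurable_fun_pair _ _ _ (g_sigma_algebraType (past eps t))) mB => //.
    by move=> _ C mC; rewrite setTI; exact: lags_past.
  by move=> _ C mC; rewrite setTI; exact: lags_past.
have -> : mean_dist P j (fun w => F (lags q Y t w, eps t w))
    (fun w => F (lags q Z t w, eps t w)) = (\int[P]_w h (V w, eps t w))%E.
  by apply: eq_integral => w _; rewrite /h/= !extFE//; exact: lags_in.
apply: (@le_trans _ _ (\int[P]_w (EFin \o bnd) (V w))%E).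
  apply: (@past_integral_le _ _ _ _ _ _ eps _ _ h mh _ t V
    [set y | tuples_in E y.1 /\ tuples_in E y.2] (EFin \o bnd)) => //.
  - by move=> x; rewrite lee_fin.
  - by move=> w; split; exact: lags_in.
  - exact/measurable_EFinP.
  - move=> y; rewrite lee_fin sumr_ge0// => il _.
    by rewrite mulr_ge0//; exact: A0.
  - move=> [y y'] [/= Ey Ey'].
    have := A2 Ey Ey' j; rewrite /expectation_vec expectation.unlock.
    congr (_ <= _)%E.
      by apply: eq_integral => w _; rewrite /h/= !extFE// !mxE.
    congr EFin; rewrite /bnd summxE -(pair_bigA _ (fun i l => A i j l *
      `|(tnth y i : 'cV[R]_k) l 0 - (tnth y' i : 'cV[R]_k) l 0|))/=.
    by apply: eq_bigr => i _; rewrite mxE; apply: eq_bigr => l _; rewrite !mxE.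
rewrite (@ge0_integral_weighted_sum _ (fun il => A il.1 j il.2)
  (fun il w => `|(tnth (V w).1 il.1 : 'cV[R]_k) il.2 0 -
                 (tnth (V w).2 il.1 : 'cV[R]_k) il.2 0|))//; last first.
- move=> il; apply: (measurableT_comp (mdis il)).
  by move=> _ B mB; rewrite setTI; apply: (@past_measurable _ _ _ _ _ _ eps t); exact: pV.
- by move=> il; exact: A0.
rewrite mulmx_suml summxE; apply: (@le_trans _ _
    (\sum_(il : 'I_q * 'I_k) (A il.1 j il.2 * b il.2 0)%:E)%E).
  apply: lee_sum => -[i l] _ /=; rewrite EFinM lee_wpmul2l// ?lee_fin; first exact: A0.
  apply: le_trans (YZb (t - (i.+1)%:Z) l).
  rewrite le_eqVlt; apply/orP; left; apply/eqP.
  by apply: eq_integral => w _; rewrite !tnth_mktuple.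
rewrite sumEFin lee_fin le_eqVlt; apply/orP; left; apply/eqP.
rewrite -(pair_bigA _ (fun i l => A i j l * b l 0))/=.
by apply: eq_bigr => i _; rewrite mxE.
Qed.

(** * Uniqueness of the integrable stationary solution *)

Variables (N : 'cV[R]_k -> R).
Hypotheses (hk : (0 < k)%N) (hA : spectral_radius (\sum_i A i) < 1)
  (hN : is_norm N).

Lemma stationary_integral Z t (h : borelV R k -> \bar R) :
  (forall t, measurable_fun setT (Z t)) -> stationary P Z ->
  measurable_fun setT h -> (forall x, (0 <= h x)%E) ->
  (\int[P]_w h (Z t w) = \int[P]_w h (Z 0%R w))%E.
Proof.
move=> mZ sZ mh h0.
pose X s : {mfun T >-> borelV R k} := mfun_Sub (mem_set (mZ s)).
transitivity (\int[distribution P (X t)]_x h x)%E.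
  by rewrite ge0_integral_distribution.
transitivity (\int[distribution P (X 0%R)]_x h x)%E; last first.
  by rewrite ge0_integral_distribution.
apply: eq_measure_integral => B mB _.
(* Stationarity is applied, with shift [t], to the event that coordinate 0 of the trajectory lies in
   [B]. *)
have := sZ t [set x | B (x 0)]; rewrite /preimage/= add0r; apply.
apply: sub_sigma_algebra; exists 0 => //; exists B => //.
by rewrite setTI.
Qed.

Lemma mean_dist0_lty j (W : T -> borelV R k) : measurable_fun setT W ->
  ('E_P[fun w => N (W w)] < +oo)%E -> (mean_dist P j W (cst 0%R) < +oo)%E.
Proof.
move=> mW; rewrite expectation.unlock => NW.
have [c c0 cN] := entry_le_normN hN.
have mNW : measurable_fun setT (fun w => (N (W w))%:E).
  apply/measurable_EFinP.
  exact: (measurableT_comp (measurable_borelV (normN_continuous hN))).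
have N0 w : (0 <= (N (W w))%:E)%E by rewrite lee_fin norm_ge0N.
apply: (@le_lt_trans _ _ (c%:E * \int[P]_w (N (W w))%:E)%E).
  rewrite -ge0_integralZl_EFin//; apply: ge0_le_integral => //.
  - exact: measurable_fun_dist.
  - exact: measurable_funeM.
  - by move=> w _; rewrite -EFinM lee_fin mxE subr0.
by rewrite lte_mul_pinfty ?lee_fin// ge0_fin_numE// integral_ge0.
Qed.

(** Stationarity makes these distances independent of time and integrability makes them finite; this
    is the uniform bound that the contraction needs at its start. *)
Lemma solution_bounded Y : integrable_stationary_solution eps E N F Y ->
  exists b : 'I_k -> R, forall t j, mean_dist P j (Y t) (cst 0%R) = (b j)%:E.
Proof.
move=> [_ sY naY _ iY].
have mY t : measurable_fun setT (Y t).
  by apply: adapted_measurable; exact/adaptedP.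
exists (fun j => fine (mean_dist P j (Y 0) (cst 0%R))) => t j.
rewrite fineK; last by rewrite ge0_fin_numE ?mean_dist_ge0// mean_dist0_lty.
apply: (stationary_integral t (h := fun x =>
  (`|(x : 'cV[R]_k) j 0 - (0 : 'cV[R]_k) j 0|)%:E)) => //.
exact: measurable_fun_dist.
Qed.

Lemma mean_dist_solution Y Z t j : integrable_stationary_solution eps E N F Y ->
  integrable_stationary_solution eps E N F Z ->
  mean_dist P j (Y t) (Z t) = mean_dist P j (fun w => F (lags q Y t w, eps t w))
                                           (fun w => F (lags q Z t w, eps t w)).
Proof.
move=> [EY _ /adaptedP aY sY _] [EZ _ /adaptedP aZ sZ _].
have mY s := adapted_measurable s aY; have mZ s := adapted_measurable s aZ.
have mFY s := adapted_measurable s (adapted_recursion aY EY).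
have mFZ s := adapted_measurable s (adapted_recursion aZ EZ).
rewrite (mean_dist_ae_eq _ _ _ (mFZ t) (sZ t))// mean_distC.
by rewrite (mean_dist_ae_eq _ _ _ (mFY t) (sY t))// mean_distC.
Qed.

Lemma solution_unique Y Z : integrable_stationary_solution eps E N F Y ->
  integrable_stationary_solution eps E N F Z ->
  forall t, {ae P, forall w, Y t w = Z t w}.
Proof.
move=> sY sZ t.
have [EY _ /adaptedP aY _ _] := sY; have [EZ _ /adaptedP aZ _ _] := sZ.
have mY s := adapted_measurable s aY; have mZ s := adapted_measurable s aZ.
have [bY YbY] := solution_bounded sY; have [bZ ZbZ] := solution_bounded sZ.
(* Initial bound, by the triangle inequality through the zero vector. *)
pose b : 'cV[R]_k := \col_j (bY j + bZ j).
(* Both processes are reproduced by the recursion, so each use of the contraction multiplies the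
   bound by the sum of the A_i. *)
have YZb n : forall s l, (mean_dist P l (Y s) (Z s) <=
    (iter n (mulmx (\sum_i A i)) b l 0)%:E)%E.
  elim: n => [s l|n IHn s l]; last first.
    by rewrite (mean_dist_solution _ _ sY sZ); exact: contraction.
  rewrite /= mxE EFinD -(YbY s) -(ZbZ s) (mean_distC _ _ (Z s)).
  exact: mean_dist_triangle.
have [K [r [K0 r01 AK]]] := iter_mulmx_geometric b hk hA.
apply: mean_dist0_ae_eq => // j.
apply: (@le_geometric_eq0 _ K r) => // [|n]; first exact: mean_dist_ge0.
by apply: le_trans (YZb n t j) _; rewrite lee_fin (le_trans (ler_norm _)).
Qed.

(** * Existence, by iteration from a constant *)

Hypothesis A1 : forall y : q.-tuple (borelV R k), tuples_in E y ->
  ('E_P[fun w => N (F (y, eps 0%R w))] < +oo)%E.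

(* The iterates are functions of the trajectory of the noise, on which the shift
   acts: this is where the stationarity of the limit comes from. *)
Fixpoint iterate (n : nat) : int -> (int -> G) -> borelV R k :=
  if n is n'.+1
  then fun t e => F ([tuple iterate n' (t - (i.+1)%:Z) e | i < q], e t)
  else fun _ _ => x0.

Definition approx n t (w : T) : borelV R k := iterate n t (fun s => eps s w).

Definition solution t (w : T) : borelV R k :=
  trunc_lim x0 (fun n => approx n t w).

Lemma iterate_in n t e : E (iterate n t e).
Proof.
by elim: n t => [//|n IHn] t; apply: hFE => i; rewrite tnth_mktuple; exact: IHn.
Qed.

Lemma iterate_shift n t h e :
  iterate n (t + h) e = iterate n t (fun s => e (s + h)).
Proof.
elim: n t => [//|n IHn] t /=; congr (F (_, _)).
by apply: eq_mktuple => i; rewrite addrAC IHn.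
Qed.

Lemma approxS n t :
  approx n.+1 t = (fun w => F (lags q (approx n) t w, eps t w)).
Proof. by []. Qed.

Lemma approx_adapted n : adapted (approx n).
Proof.
elim: n => [|n IHn].
  move=> t B mB; rewrite -[X in <<s _ >> X]setTI.
  exact: (@measurable_cst _ _ (g_sigma_algebraType (past eps (t + 1)))).
by apply: (adapted_recursion IHn) => t w; exact: iterate_in.
Qed.

Lemma measurable_approx n t : measurable_fun setT (approx n t).
Proof. by apply: adapted_measurable; exact: approx_adapted. Qed.

(** Measurability of the truncated limit is used on [T] endowed with the sigma-algebra of the noise
    up to [t]. It applies because the test for truncation depends on that noise only and the limit
    exists at every point. *)
Lemma solution_adapted : adapted solution.
Proof.
move=> t B mB; rewrite -[X in <<s _ >> X]setTI.
apply: (@measurable_trunc_lim _ _ x0 _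
  (g_sigma_algebraType (past eps (t + 1))) (approx ^~ t)) mB => // n _ C mC.
by rewrite setTI; exact: approx_adapted.
Qed.

Lemma measurable_solution t : measurable_fun setT (solution t).
Proof. by apply: adapted_measurable; exact: solution_adapted. Qed.

Lemma solution_in t w : E (solution t w).
Proof. by apply: trunc_lim_closed => // n; exact: iterate_in. Qed.

(** The solution is a function [L] of the noise, with [L] measurable and commuting with the shift;
    the shifted noise has the law of the noise. *)
Lemma solution_stationary : stationary P solution.
Proof.
move=> h B mB.
pose coord (t : int) (e : int -> G) := e t.
pose Omega := g_sigma_algebraType
  (\bigcup_(t in [set: int]) preimage_set_system setT (coord t) measurable).
have mcoord t : measurable_fun setT (coord t : Omega -> G).
  by move=> _ C mC; apply: sub_sigma_algebra; exists t => //; exists C.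
have miter n t : measurable_fun setT (iterate n t : Omega -> borelV R k).
  elim: n t => [|n IHn] t; first exact: measurable_cst.
  apply: (measurable_recursion (S := Omega)
    (V := fun e => [tuple iterate n (t - (i.+1)%:Z) e | i < q])) => //.
    apply/measurable_fun_tnthP => i.
    rewrite (_ : _ \o _ = iterate n (t - (i.+1)%:Z)); first exact: IHn.
    by apply/funext => e; exact: tnth_mktuple.
    exact: mcoord.
  by move=> e i; rewrite tnth_mktuple; exact: iterate_in.
pose L (e : Omega) (t : int) : borelV R k := trunc_lim x0 (fun n => iterate n t e).
have mL : sigma_family setT coord (L @^-1` B).
  apply: (sigma_family_preimage (D := setT) (T := Omega)
    (f := fun (t : int) (x : int -> borelV R k) => x t)) mB => t _.
  exact: (@measurable_trunc_lim _ _ x0 _ Omega).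
have := iid_shift h heps mL; congr (P _ = P _).
apply/seteqP; split=> w /=; congr B; apply/funext => t;
  by rewrite /L/= /solution; congr trunc_lim; apply/funext => n;
    rewrite /approx iterate_shift.
Qed.

(** Successive iterates are images of successive iterates, so the contraction reduces the bound to
    the first step, which (A1) makes finite. *)
Lemma approx_step : exists K r : R, [/\ 0 <= K, 0 < r < 1 & forall n t j,
  (mean_dist P j (approx n.+1 t) (approx n t) <= (K * r ^+ n)%:E)%E].
Proof.
pose y0 : q.-tuple (borelV R k) := [tuple x0 | i < q].
have Ey0 : tuples_in E y0 by move=> i; rewrite tnth_mktuple.
have mF t : measurable_fun setT (fun w => F (y0, eps t w)).
  by apply: measurable_recursion => //; exact: measurable_noise.
pose m j := mean_dist P j (fun w => F (y0, eps 0%R w)) (cst 0%R).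
have moo j : (m j < +oo)%E by apply: mean_dist0_lty => //; exact: A1.
have m0 j : (0 <= m j)%E by exact: mean_dist_ge0.
(* (A1) is stated at time 0; equality of laws carries it to every [t]. *)
have mt j t : mean_dist P j (fun w => F (y0, eps t w)) (cst 0%R) = m j.
  pose h (yg : q.-tuple (borelV R k) * G) : \bar R :=
    (`|(extF yg : 'cV[R]_k) j 0 - (0 : 'cV[R]_k) j 0|)%:E.
  transitivity (\int[P]_w h (y0, eps t w))%E.
    by apply: eq_integral => w _; rewrite /h extFE.
  rewrite (@noise_integral_id _ _ _ _ _ _ _ _ _ _ _ _ t 0%R _ heps.2)//.
  - by apply: eq_integral => w _; rewrite /h extFE.
  - by apply: measurable_fun_dist; [exact: measurable_extF|exact: measurable_cst].
  - by move=> yg; rewrite lee_fin.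
(* The first step goes from [x0] to the image of the constant tuple, and is bounded through the zero
   vector. *)
pose b : 'cV[R]_k := \col_j (fine (m j) + `|x0 j 0|).
have stepb n : forall t j, (mean_dist P j (approx n.+1 t) (approx n t) <=
    (iter n (mulmx (\sum_i A i)) b j 0)%:E)%E.
  elim: n => [|n IHn] s i; last first.
    have Eapprox p u w : E (approx p u w) by exact: iterate_in.
    exact: (contraction (approx_adapted n.+1) (approx_adapted n)
      (Eapprox n.+1) (Eapprox n) IHn).
  apply: (le_trans (@mean_dist_triangle _ _ _ P _ i _ (cst 0%R) _ _ _ _)).
  - exact: measurable_approx.
  - exact: measurable_cst.
  - exact: measurable_approx.
  rewrite (_ : approx 1 s = (fun w => F (y0, eps s w)))// mt /= mxE EFinD.
  rewrite fineK ?ge0_fin_numE// leeD2l//.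
  rewrite /mean_dist/= /approx/=.
  under eq_integral do rewrite mxE sub0r normrN.
  by rewrite integral_cst//= probability_setT mule1.
have [K [r [K0 r01 AK]]] := iter_mulmx_geometric b hk hA.
exists K, r; split=> // n t j; apply: le_trans (stepb n t j) _.
by rewrite lee_fin (le_trans (ler_norm _)).
Qed.

(** The sum of the increments has finite expectation, hence is finite almost surely. *)
Lemma approx_summable t :
  {ae P, forall w, (sum_increments (fun n => approx n t w) < +oo)%E}.
Proof.
have [K [r [K0 /andP[r0 r1] step]]] := approx_step.
have mtv := measurable_sum_increments (fun n => measurable_approx n t).
have tv0 w : (0 <= sum_increments (fun n => approx n t w))%E.
  by apply: nneseries_ge0 => n _ _; rewrite lee_fin increment_ge0.
have itv : P.-integrable setT (fun w => sum_increments (fun n => approx n t w)).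
  apply/integrableP; split => //.
  under eq_integral do rewrite gee0_abs//.
  (* The factor [k] counts the coordinates and 1 / (1 - r) sums the geometric series. *)
  apply: (@le_lt_trans _ _ (k%:R * K * (1 - r)^-1)%:E); last exact: ltry.
  rewrite integral_nneseries//; last 2 first.
  - move=> n; apply/measurable_EFinP.
    exact: (measurable_increment (fun n => measurable_approx n t)).
  - by move=> n w _; rewrite lee_fin increment_ge0.
  apply: lime_le.
    apply: is_cvg_nneseries => n _ _; apply: integral_ge0 => w _.
    by rewrite lee_fin increment_ge0.
  apply: nearW => n.
  apply: (@le_trans _ _ (\sum_(0 <= i < n) (k%:R * K * r ^+ i)%:E)%E).
    apply: lee_sum => i _.
    have -> : (\int[P]_w (increment (fun n => approx n t w) i)%:E)%E =
        (\sum_j mean_dist P j (approx i.+1 t) (approx i t))%E.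
      rewrite /increment; under eq_integral do rewrite -sumEFin.
      rewrite ge0_integral_sum// => j.
      by apply: measurable_fun_dist; exact: measurable_approx.
    apply: le_trans (lee_sum _ (fun j _ => step i t j)) _.
    by rewrite sumEFin lee_fin sumr_const card_ord mulr_natl -mulrnAl.
  rewrite sumEFin lee_fin -[leLHS]/(series (geometric (k%:R * K) r) n).
  rewrite geometric_seriesE ?lt_eqF//=; apply: ler_wpM2r.
    by rewrite invr_ge0 subr_ge0 ltW.
  by rewrite ler_piMr ?mulr_ge0// gerBl exprn_ge0// ltW.
have := integrable_ae measurableT itv; apply: filterS => w /(_ I).
by rewrite ge0_fin_numE.
Qed.

Lemma approx_trunc n t : {ae P, forall w,
  trunc x0 (fun n => approx n t w) n = approx n t w}.
Proof.
by have := approx_summable t; apply: filterS => w wtv; rewrite /trunc wtv.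
Qed.

(** The steps after rank [n] sum to at most M r^n, with M = K / (1 - r); Fatou's lemma passes to the
    limit. *)
Lemma approx_solution : exists M r : R, [/\ 0 <= M, 0 < r < 1 & forall n t j,
  (mean_dist P j (approx n t) (solution t) <= (M * r ^+ n)%:E)%E].
Proof.
have [K [r [K0 /andP[r0 r1] step]]] := approx_step.
have r1' : 0 < 1 - r by rewrite subr_gt0.
pose M := K / (1 - r).
exists M, r; split => //.
- by rewrite divr_ge0// ltW.
- by rewrite r0 r1.
move=> n t j.
(* Induction on [p], uniformly in the starting rank: K + M r = M. *)
have dist_add p n' : (mean_dist P j (approx n' t) (approx (n' + p) t) <=
    (M * r ^+ n')%:E)%E.
  elim: p n' => [|p IHp] n'.
    rewrite addn0 /mean_dist; under eq_integral do rewrite subrr normr0.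
    by rewrite integral0 lee_fin mulr_ge0 ?divr_ge0 ?exprn_ge0// ltW.
  apply: (le_trans (@mean_dist_triangle _ _ _ P _ j _ (approx n'.+1 t) _ _ _ _));
    try exact: measurable_approx.
  rewrite -addSnnS mean_distC; apply: le_trans (leeD (step n' t j) (IHp n'.+1)) _.
  rewrite -EFinD lee_fin exprS mulrA -mulrDl ler_wpM2r ?exprn_ge0 ?(ltW r0)//.
  rewrite le_eqVlt; apply/orP; left; apply/eqP.
  by rewrite /M; field; rewrite gt_eqF.
have mtr p := measurable_trunc x0 (fun n => measurable_approx n t) p.
(* [fatou_le] asks for convergence at every point, so the truncated sequence is used; it equals the
   iterates almost surely. *)
apply: (fatou_le (f_ := fun p w => (`|(approx n t w : 'cV[R]_k) j 0 -
  trunc x0 (fun n => approx n t w) (n + p) j 0|)%:E)).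
- by move=> p; apply: measurable_fun_dist => //; exact: measurable_approx.
- by move=> p w; rewrite lee_fin.
- move=> w; apply: cvg_EFin; first exact: nearW.
  apply: cvg_norm; apply: cvgB; first exact: cvg_cst.
  pose u p := trunc x0 (fun n => approx n t w) p j 0.
  have tl : u p @[p --> \oo] --> (solution t w : 'cV[R]_k) j 0.
    exact: trunc_coord_cvg.
  rewrite -(cvg_shiftn n) in tl.
  by apply: cvg_trans tl; apply: near_eq_cvg; apply: nearW => p; rewrite /= addnC.
- move=> p.
  rewrite -/(mean_dist P j (approx n t)
    (fun w => trunc x0 (fun n => approx n t w) (n + p))).
  rewrite (mean_dist_ae_eq _ _ _ _ (approx_trunc (n + p) t))//;
    exact: measurable_approx.
Qed.

(** Both sides are close in mean to [approx n.+1]: the solution by the rate of convergence, its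
    image by contraction from [approx n]. Their distance is thus below C r^n for every n. *)
Lemma solution_solves : solves eps F solution.
Proof.
have [M [r [M0 r01 asol]]] := approx_solution.
move=> t.
have mFs := adapted_measurable t (adapted_recursion solution_adapted solution_in).
apply: mean_dist0_ae_eq => // [|j]; first exact: measurable_solution.
(* [M * r] comes from the rate at rank n + 1, the other term from the contraction applied to the
   constant vector M r^n. *)
apply: (@le_geometric_eq0 _
  (M * r + ((\sum_i A i) *m (const_mx M : 'cV_k)) j 0) r) => // [|n].
  exact: mean_dist_ge0.
apply: (le_trans (@mean_dist_triangle _ _ _ P _ j _ (approx n.+1 t) _ _ _ _)) => //.
- exact: measurable_solution.
- exact: measurable_approx.
rewrite mulrDl EFinD leeD//.
  by rewrite mean_distC -mulrA -exprS; exact: asol.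
rewrite approxS.
apply: (le_trans (@contraction _ _ (const_mx (M * r ^+ n)) _ _ _ _ _ _ _)).
- exact: approx_adapted.
- exact: solution_adapted.
- by move=> ? ?; exact: iterate_in.
- exact: solution_in.
- by move=> s l; rewrite mxE; exact: asol.
rewrite lee_fin !mxE mulr_suml le_eqVlt; apply/orP; left; apply/eqP.
by apply: eq_bigr => l _; rewrite !mxE mulrA.
Qed.

(** The solution is at finite mean distance from [approx 0], which is the constant [x0], and [N] is
    bounded by a multiple of the sum of the moduli of the coordinates. *)
Lemma solution_integrable t : ('E_P[fun w => N (solution t w)] < +oo)%E.
Proof.
have [M [r [M0 r01 asol]]] := approx_solution.
have sol0 j : (mean_dist P j (solution t) (cst 0%R) < +oo)%E.
  apply: (le_lt_trans (@mean_dist_triangle _ _ _ P _ j _ (approx 0 t) _ _ _ _)).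
  - exact: measurable_solution.
  - exact: measurable_approx.
  - exact: measurable_cst.
  rewrite lte_add_pinfty//.
    by rewrite mean_distC; apply: le_lt_trans (asol 0%N t j) (ltry _).
  by rewrite /mean_dist/= /approx/= integral_cst//= probability_setT mule1 ltry.
rewrite expectation.unlock.
pose c := \sum_j N (delta_mx j 0).
have c0 : 0 <= c by apply: sumr_ge0 => j _; exact: norm_ge0N.
pose f j w := `|(solution t w : 'cV[R]_k) j 0 - (0 : 'cV[R]_k) j 0|.
have mf j : measurable_fun setT (f j).
  apply/measurable_EFinP; apply: measurable_fun_dist => //.
  exact: measurable_solution.
apply: (@le_lt_trans _ _ (\int[P]_w (\sum_j c * f j w)%:E)%E).
  apply: ge0_le_integral => //.
  - by move=> w _; rewrite lee_fin norm_ge0N.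
  - apply/measurable_EFinP.
    apply: (measurableT_comp (measurable_borelV (normN_continuous hN))).
    exact: measurable_solution.
  - apply/measurable_EFinP; apply: measurable_sum => j.
    exact: measurable_funM.
  - move=> w _; rewrite lee_fin -mulr_sumr /c mulr_suml; apply: normN_le => // j.
    by rewrite (bigD1 j)//= /f mxE subr0 lerDl sumr_ge0.
rewrite (ge0_integral_weighted_sum (a := fun=> c))//; last first.
  by move=> j w; exact: normr_ge0.
apply: lte_sum_pinfty => j _.
by rewrite lte_mul_pinfty ?lee_fin//; exact: sol0.
Qed.

Lemma solution_correct : integrable_stationary_solution eps E N F solution.
Proof.
split.
- exact: solution_in.
- exact: solution_stationary.
- by apply/adaptedP; exact: solution_adapted.
- exact: solution_solves.
- exact: solution_integrable.
Qed.

(** * Moments of phi *)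

Section moments.
Context (kb : nat) (phi : 'cV[R]_k -> 'cV[R]_kb) (r : R)
  (D : 'I_q -> 'M[R]_kb) (c : 'cV[R]_kb).
Hypotheses (kb1 : (1 < kb)%N)
  (cphi : forall j : 'I_kb, {within E, continuous (fun x => phi x j 0)})
  (phi0 : forall x, E x -> nonneg_mx (phi x))
  (r1 : 1 <= r)
  (D0 : forall i, nonneg_mx (D i))
  (hD : spectral_radius (\sum_(i < q) D i) < 1)
  (c0 : nonneg_mx c)
  (A3 : forall y : q.-tuple (borelV R k), tuples_in E y ->
     vle (Lnorm_vec P r (fun w => phi (F (y, eps 1 w))))
         (c + \sum_(i < q) D i *m phi (tnth y i))).

Lemma measurable_phi dS (S : measurableType dS) (W : S -> borelV R k) j :
  measurable_fun setT W -> (forall s, E (W s)) ->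
  measurable_fun setT (fun s => phi (W s) j 0).
Proof.
move=> mW EW.
apply: (measurable_comp (F := (E : set (borelV R k)))
  (f := (fun x : borelV R k => phi x j 0)) _ _ _ mW).
- exact: closed_borelV.
- by move=> _ [s _ <-]; exact: EW.
- exact: measurable_within_borelV.
Qed.

(** [past_integral_le] asks for a bound measurable and nonnegative on all tuples, whereas phi is
    controlled only on [E]. *)
Let retract (x : borelV R k) : borelV R k := if x \in E then x else x0.

Let retract_in x : E (retract x).
Proof. by rewrite /retract; case: ifPn => // /set_mem. Qed.

Let retractE x : E x -> retract x = x.
Proof. by move=> Ex; rewrite /retract mem_set. Qed.

Let measurable_retract : measurable_fun setT retract.
Proof.
apply: measurable_fun_if => //.
apply: (@measurable_fun_bool _ _ _ _ true).
rewrite (_ : _ @^-1` _ = E) ?setTI; first exact: closed_borelV.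
by apply/seteqP; split=> x /=; [move/set_mem|move/mem_set].
Qed.

Lemma extF_in yg : E (extF yg).
Proof.
by case: yg => y g; rewrite /extF/=; case: ifPn => // /set_mem /hFE.
Qed.

Local Notation nu f := (Lnorm P r%:E (fun w => (f w)%:E)).

(** (A3), raised to the power [r], is integrated over the past; Minkowski's inequality then bounds
    the norm of the resulting combination of lagged values. *)
Lemma moment_recursion Z (b : 'cV[R]_kb) : adapted Z ->
  (forall t w, E (Z t w)) -> (forall l, 0 <= b l 0) ->
  (forall s l, (nu (fun w => phi (Z s w) l 0%R) <= (b l 0)%:E)%E) ->
  forall t j, (nu (fun w => phi (F (lags q Z t w, eps t w)) j 0%R) <=
               ((c + (\sum_i D i) *m b) j 0)%:E)%E.
Proof.
move=> aZ EZ b0 Zb t j.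
pose S := q.-tuple (borelV R k).
pose h (yg : S * G) : \bar R := (`|phi (extF yg) j 0| `^ r)%:E.
pose bnd (y : S) : R := c j 0 + \sum_(il : 'I_q * 'I_kb)
  D il.1 j il.2 * phi (retract (tnth y il.1)) il.2 0.
have mphi (il : 'I_q * 'I_kb) :
    measurable_fun setT (fun y : S => phi (retract (tnth y il.1)) il.2 0).
  apply: measurable_phi => //.
  by apply: measurableT_comp => //; exact: measurable_tnth.
have mpow (g : S -> R) : measurable_fun setT g ->
    measurable_fun setT (fun y => (`|g y| `^ r)%:E).
  move=> mg; apply/measurable_EFinP.
  by apply: (measurableT_comp (measurable_powR r)); exact: measurableT_comp.
have mh : measurable_fun setT h.
  apply/measurable_EFinP; apply: (measurableT_comp (measurable_powR r)).
  apply: measurableT_comp => //; apply: measurable_phi => //.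
    exact: measurable_extF.
  exact: extF_in.
have mbnd : measurable_fun setT bnd.
  apply: measurable_funD => //; apply: measurable_sum => il.
  exact: measurable_funM.
have bnd0 y : 0 <= bnd y.
  apply: addr_ge0; first exact: c0.
  apply: sumr_ge0 => il _; rewrite mulr_ge0//; first exact: D0.
  exact: phi0.
have bE : (c + (\sum_i D i) *m b) j 0 =
    c j 0 + \sum_(il : 'I_q * 'I_kb) D il.1 j il.2 * b il.2 0.
  rewrite mulmx_suml mxE summxE -(pair_bigA _ (fun i l => D i j l * b l 0))/=.
  by congr (_ + _); apply: eq_bigr => i _; rewrite mxE.
have bE0 : 0 <= (c + (\sum_i D i) *m b) j 0.
  rewrite bE; apply: addr_ge0; first exact: c0.
  apply: sumr_ge0 => il _; rewrite mulr_ge0//; exact: D0.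
have lagsE (il : 'I_q * 'I_kb) w : retract (tnth (lags q Z t w) il.1) =
    Z (t - (il.1.+1)%:Z) w.
  by rewrite retractE tnth_mktuple//; exact: EZ.
have mlags : measurable_fun setT (lags q Z t).
  move=> _ B mB; rewrite setTI.
  by apply: (@past_measurable _ _ _ _ _ _ eps t); exact: lags_past.
apply/(Lnorm_le_powR _ r1) => //.
have -> : (\int[P]_w (`|phi (F (lags q Z t w, eps t w)) j 0| `^ r)%:E =
    \int[P]_w h (lags q Z t w, eps t w))%E.
  by apply: eq_integral => w _; rewrite /h extFE//; exact: lags_in.
apply: (@le_trans _ _ (\int[P]_w (`|bnd (lags q Z t w)| `^ r)%:E)%E).
  apply: (@past_integral_le _ _ _ _ _ _ eps _ _ h mh _ t (lags q Z t)
    (tuples_in E) (fun y => (`|bnd y| `^ r)%:E)) => //.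
  - by move=> yg; rewrite lee_fin powR_ge0.
  - by move=> B mB; exact: lags_past.
  - by move=> w; exact: lags_in.
  - exact: mpow.
  - move=> y Ey; rewrite ger0_norm//.
    have -> : (\int[P]_w h (y, eps 1 w) =
        \int[P]_w (`|phi (F (y, eps 1 w)) j 0| `^ r)%:E)%E.
      by apply: eq_integral => w _; rewrite /h extFE.
    apply/(Lnorm_le_powR _ r1) => //.
    have := A3 Ey j; rewrite /Lnorm_vec; congr (_ <= _)%E; congr EFin.
    rewrite /bnd mxE summxE.
    rewrite -(pair_bigA _ (fun i l => D i j l * phi (retract (tnth y i)) l 0))/=.
    congr (_ + _); apply: eq_bigr => i _; rewrite mxE; apply: eq_bigr => l _.
    by rewrite retractE.
apply/(Lnorm_le_powR _ r1) => //; rewrite bE.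
have := @Lnorm_weighted_sum _ _ _ P r r1 ('I_q * 'I_kb)%type
  (fun il => D il.1 j il.2) (fun il => b il.2 0)
  (fun il w => phi (retract (tnth (lags q Z t w) il.1)) il.2 0) (c j 0).
rewrite /bnd; apply => //.
- by move=> il; exact: D0.
- by move=> il; exact: measurableT_comp (mphi il) mlags.
- move=> il; apply: le_trans (Zb (t - (il.1.+1)%:Z) il.2).
  by under [X in Lnorm _ _ X]eq_fun do rewrite lagsE.
Qed.

(** The increments of the affine recursion m_(n+1) = c + D m_n are D^n (m_1 - m_0), which decay
    geometrically, so its values stay bounded. *)
Lemma approx_moment : exists B : R, 0 <= B /\
  forall n t j, (nu (fun w => phi (approx n t w) j 0%R) <= B%:E)%E.
Proof.
pose f (x : 'cV[R]_kb) := c + (\sum_i D i) *m x.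
pose m n := iter n f (phi x0).
have f0 (x : 'cV[R]_kb) : (forall l, 0 <= x l 0) -> forall l, 0 <= f x l 0.
  move=> xl0 l; rewrite mxE addr_ge0//.
  rewrite mxE; apply: sumr_ge0 => i _; rewrite mulr_ge0// summxE.
  by apply: sumr_ge0 => i' _; exact: D0.
have m0 n l : 0 <= m n l 0.
  elim: n l => [l|n IHn l]; first exact: phi0.
  by rewrite /m iterS; exact: f0.
have appm n : forall t j, (nu (fun w => phi (approx n t w) j 0%R) <= (m n j 0)%:E)%E.
  elim: n => [t j|n IHn t j]; first exact: (Lnorm_cst P r1 (phi0 Ex0 j 0)).
  apply: (moment_recursion (approx_adapted n)) => // ? ?.
  exact: iterate_in.
have kb0 : (0 < kb)%N by exact: ltn_trans kb1.
have [K [s [K0 /andP[s0 s1] Ks]]] := iter_mulmx_geometric (m 1%N - m 0%N) kb0 hD.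
have mS n : m n.+1 - m n = iter n (mulmx (\sum_i D i)) (m 1%N - m 0%N).
  elim: n => [//|n IHn]; rewrite iterS -IHn /m !iterS /f.
  by rewrite opprD addrACA subrr add0r mulmxBr.
pose M := K / (1 - s).
have KM : K = M * (1 - s) by rewrite /M divfK// subr_eq0 gt_eqF.
have M0 : 0 <= M by rewrite divr_ge0// subr_ge0 ltW.
(* Sum of the geometric increments: K (1 + ... + s^(n-1)) = M (1 - s^n). *)
have mM n l : m n l 0 <= m 0%N l 0 + M * (1 - s ^+ n).
  elim: n => [|n IHn]; first by rewrite expr0 subrr mulr0 addr0.
  have -> : m n.+1 l 0 = m n l 0 + (m n.+1 - m n) l 0 by rewrite !mxE subrKC.
  rewrite mS; apply: le_trans (lerD IHn (le_trans (ler_norm _) (Ks n l))) _.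
  by rewrite KM -addrA lerD2l -mulrA -mulrDr ler_wpM2l// exprS; lra.
(* Summing the initial bounds over all coordinates gives a constant independent of [j]. *)
exists (\sum_l m 0%N l 0 + M); split.
  by rewrite addr_ge0// sumr_ge0// => l _; exact: (m0 0%N l).
move=> n t j; apply: le_trans (appm n t j) _; rewrite lee_fin.
apply: le_trans (mM n j) _; apply: lerD.
  by rewrite (bigD1 j)//= lerDl sumr_ge0// => l _; exact: (m0 0%N l).
by rewrite ler_piMr// gerBl exprn_ge0// ltW.
Qed.

(** phi is continuous only within [E], but the truncated iterates stay in [E] and converge
    everywhere to the solution, so phi converges along them and Fatou's lemma applies. *)
Lemma solution_moment : exists B : R, 0 <= B /\
  forall t j, (nu (fun w => phi (solution t w) j 0%R) <= B%:E)%E.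
Proof.
have [B [B0 appB]] := approx_moment.
exists B; split => // t j; apply/(Lnorm_le_powR _ r1) => //.
pose u n w := trunc x0 (fun n => approx n t w) n.
have Eu n w : E (u n w) by rewrite /u /trunc; case: ifP => // _; exact: iterate_in.
have mu n : measurable_fun setT (u n : T -> borelV R k).
  exact: (measurable_trunc x0 (fun n => measurable_approx n t)).
have mpow (W : T -> borelV R k) : measurable_fun setT W -> (forall w, E (W w)) ->
    measurable_fun setT (fun w => (`|phi (W w) j 0| `^ r)%:E).
  move=> mW EW; apply/measurable_EFinP.
  apply: (measurableT_comp (measurable_powR r)).
  by apply: measurableT_comp => //; exact: measurable_phi.
apply: (fatou_le (f_ := fun n w => (`|phi (u n w) j 0| `^ r)%:E)).
- by move=> n; exact: mpow.
- by move=> n w; rewrite lee_fin powR_ge0.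
- move=> w; apply: cvg_EFin; first exact: nearW.
  apply: (@cvg_powR _ r (fun n => `|phi (u n w) j 0|)) => //.
  apply: cvg_norm.
  have wphi : phi x j 0 @[x --> within E (nbhs (solution t w : 'cV[R]_k))] -->
      phi (solution t w) j 0.
    have /subspace_continuousP := @cphi j; apply; exact: solution_in.
  apply: (@cvg_comp _ _ _ (u ^~ w) (fun x => phi x j 0)) wphi => V EV.
  have EVu : \forall n \near \oo, E (u n w) -> V (u n w) by exact: trunc_cvg EV.
  have : \forall n \near \oo, V (u n w).
    by apply: filterS EVu => n; apply; exact: Eu.
  exact.
(* Truncated and original iterates agree almost surely, so they have the same moments. *)
- move=> n; rewrite (_ : (\int[P]_w _)%E =
      (\int[P]_w (`|phi (approx n t w) j 0| `^ r)%:E)%E).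
    by apply/(Lnorm_le_powR _ r1).
  apply: ae_eq_integral => //.
  + exact: mpow.
  + by apply: mpow; [exact: measurable_approx|move=> w; exact: iterate_in].
  + by have := approx_trunc n t; apply: filterS => w + _; rewrite /u => ->.
Qed.

(** By uniqueness [Y] may be replaced by the constructed solution, whose coordinate norms are
    bounded; Minkowski's inequality adds them. *)
Lemma integrable_solution_moment Y : integrable_stationary_solution eps E N F Y ->
  ('E_P[fun w => (norm1 (phi (Y 0 w)) `^ r)%R] < +oo)%E.
Proof.
move=> sY; have [EY _ /adaptedP aY _ _] := sY.
have YX := solution_unique sY solution_correct 0.
have [B [B0 XB]] := solution_moment.
have mnorm (W : T -> borelV R k) : measurable_fun setT W -> (forall w, E (W w)) ->
    measurable_fun setT (fun w => (norm1 (phi (W w)) `^ r)%:E).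
  move=> mW EW; apply/measurable_EFinP.
  apply: (measurableT_comp (measurable_powR r)); apply: measurable_sum => j.
  by apply: measurableT_comp => //; exact: measurable_phi.
rewrite expectation.unlock.
have -> : (\int[P]_w (norm1 (phi (Y 0%R w)) `^ r)%:E =
    \int[P]_w (norm1 (phi (solution 0%R w)) `^ r)%:E)%E.
  apply: ae_eq_integral => //.
  - by apply: mnorm => //; exact: adapted_measurable.
  - by apply: mnorm; [exact: measurable_solution|exact: solution_in].
  - by apply: filterS YX => w -> _.
(* With all weights equal to 1 the sum is |phi|_1, since phi is nonnegative on [E]. *)
have := @Lnorm_weighted_sum _ _ _ P r r1 _ (fun=> 1) (fun=> B)
  (fun j w => phi (solution 0 w) j 0) 0 (lexx _) (fun=> ler01) (fun=> B0)
  (fun j => measurable_phi j (measurable_solution 0) (solution_in 0)) (XB 0).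
rewrite Lnorm_le_powR//; last first.
  by rewrite add0r; apply: sumr_ge0 => j _; rewrite mul1r.
move=> sumB.
apply: (@le_lt_trans _ _ ((0 + \sum_(j < kb) 1 * B) `^ r)%:E); last exact: ltry.
apply: le_trans sumB; rewrite le_eqVlt; apply/orP; left; apply/eqP.
apply: eq_integral => w _; rewrite add0r ger0_norm; last first.
  by apply: sumr_ge0 => j _; rewrite mul1r; exact/phi0/solution_in.
congr (_ `^ _)%:E; apply: eq_bigr => j _.
by rewrite mul1r ger0_norm//; exact/phi0/solution_in.
Qed.

End moments.

End contraction.

End random_recursion.

Unset Implicit Arguments.

Theorem theorem2 (R : realType) (d : measure_display) (T : measurableType d)
  (P : probability T R) (dG : measure_display) (G : measurableType dG)
  (k q : nat) (hk : (0 < k)%N) (hq : (0 < q)%N)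
  (N : 'cV[R]_k -> R) (hN : is_norm N)
  (E : set 'cV[R]_k) (hE0 : E !=set0) (hEcl : closed E)
  (eps : int -> {RV P >-> G}) (heps : iid eps)
  (F : q.-tuple (borelV R k) * G -> borelV R k)
  (hFE : forall y g, tuples_in E y -> E (F (y, g)))
  (hFm : measurable_fun (tuples_in E `*` [set: G]) F)
  (A1 : forall y : q.-tuple (borelV R k), tuples_in E y ->
     ('E_P[fun w => N (F (y, eps 0%R w))] < +oo)%E)
  (A2 : exists A : 'I_q -> 'M[R]_k,
     [/\ forall i, nonneg_mx (A i),
         spectral_radius (\sum_(i < q) A i) < 1 &
         forall y y' : q.-tuple (borelV R k), tuples_in E y -> tuples_in E y' ->
         vle (expectation_vec P (fun w =>
                vabs ((F (y, eps 1 w) : 'cV[R]_k) - F (y', eps 1 w))))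
             (\sum_(i < q) A i *m vabs ((tnth y i : 'cV[R]_k) - tnth y' i))]) :
  (exists X : int -> T -> borelV R k,
     integrable_stationary_solution eps E N F X /\
     (forall Y : int -> T -> borelV R k,
        integrable_stationary_solution eps E N F Y ->
        forall t : int, {ae P, forall w, X t w = Y t w}))
  /\
  (forall (kb : nat) (phi : 'cV[R]_k -> 'cV[R]_kb) (r : R)
     (D : 'I_q -> 'M[R]_kb) (c : 'cV[R]_kb),
     (1 < kb)%N ->
     (forall j : 'I_kb, {within E, continuous (fun x => phi x j 0)}) ->
     (forall x, E x -> nonneg_mx (phi x)) ->
     1 <= r ->
     (forall i, nonneg_mx (D i)) ->
     spectral_radius (\sum_(i < q) D i) < 1 ->
     nonneg_mx c ->
     (forall y : q.-tuple (borelV R k), tuples_in E y ->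
        vle (Lnorm_vec P r (fun w => phi (F (y, eps 1 w))))
            (c + \sum_(i < q) D i *m phi (tnth y i))) ->
     forall X : int -> T -> borelV R k,
       integrable_stationary_solution eps E N F X ->
       ('E_P[fun w => (norm1 (phi (X 0%R w)) `^ r)%R] < +oo)%E).
Proof.
have [A [A0 hA A2']] := A2; have [x0 Ex0] := hE0.
have correct := solution_correct hEcl heps hFE hFm Ex0 A0 A2' hk hA hN A1.
split.
  exists (solution eps F x0); split => // Y sY.
  exact: (solution_unique hEcl heps hFm x0 A0 A2' hk hA hN correct sY).
move=> kb phi r D c kb1 cphi phi0 r1 D0 hD c0 A3 X sX.
exact: (integrable_solution_moment hEcl heps hFE hFm Ex0 A0 A2' hk hA hN A1
  kb1 cphi phi0 r1 D0 hD c0 A3 sX).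
Qed.
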